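(* Let $0\le k\le\mu$ be integers and $m\ge0$ an integer. If $0\le m\le\mu$, the operator $E_{\mu,k}$ acts on $\widetilde{\mathcal{H}_{2m}}$ as multiplication by the constant $$\frac{(-1)^k\binom{\mu}{k}(\mu!)^2\,{}_3F_2(-k,-m-\mu-1,m-\mu;-\mu,-\mu;1)}{(\mu-m)!\,(\mu+m+1)!}.$$ If $m>\mu$, $E_{\mu,k}$ acts as $0$ on $\widetilde{\mathcal{H}_{2m}}$.
   Context: $d\iota(s)=\frac{dA(s)}{\pi(1+|s|^2)^2}$ ($dA$ Lebesgue measure) is the $SU(2)$-invariant probability measure on $\mathbb{CP}^1=\mathbb{C}\cup\{\infty\}$, where $SU(2)$ acts by Möbius transformations $\begin{pmatrix}a&b\\c&d\end{pmatrix}\cdot z=\frac{az+b}{cz+d}$, and on functions by $(g\cdot f)(z)=f(g^{-1}\cdot z)$. Under this action $L^2(\mathbb{CP}^1,d\iota)=\bigoplus_{m\ge0}\widetilde{\mathcal{H}_{2m}}$ (multiplicity free), where $\widetilde{\mathcal{H}_{2m}}\subseteq C^\infty(\mathbb{CP}^1)$ is the unique irreducible invariant subspace of dimension $2m+1$. The Berezin transform is $B_\tau(f)(z)=\int_{\mathbb{C}}\frac{|1+z\overline s|^{2\tau}}{(1+|z|^2)^\tau(1+|s|^2)^\tau}f(s)\,d\iota(s)$, and $E_{\mu,k}(f):=\binom{\mu}{k}\sum_{l=0}^k(-1)^{k-l}\binom kl B_{\mu-l}(f)$. Here ${}_3F_2(a_1,a_2,a_3;b_1,b_2;1)=\sum_{l\ge0}\frac{(a_1)_l(a_2)_l(a_3)_l}{(b_1)_l(b_2)_l\,l!}$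 with rising Pochhammer symbols $(a)_l=a(a+1)\cdots(a+l-1)$; with $a_1=-k$ the sum terminates at $l=k\le\mu$. *)

(* Defs.v *)
From HB Require Import structures.
From mathcomp Require Import all_boot all_order all_algebra.
From mathcomp Require Import all_classical all_reals all_analysis.
From mathcomp Require Import complex.
Import ComplexField.
Import Order.TTheory GRing.Theory Num.Theory.
Import numFieldNormedType.Exports.

Set Implicit Arguments.
Unset Strict Implicit.
Unset Printing Implicit Defensive.

Local Open Scope ring_scope.
Local Open Scope classical_set_scope.
Local Open Scope complex_scope.

Section Defs.
Variable R : realType.
Local Notation C := R[i].

(* the complex plane with its usual (norm) topology *)
Definition Ctop : numFieldType := R[i].

(* CP^1 = C ∪ {∞}; None is the point at infinity *)
Definition CP1 := option C.

Definition SU2 (g : 'M[C]_2) : Prop :=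
  g *m (map_mx conjc g)^T = 1%:M /\ \det g = 1.

Definition mobius (g : 'M[C]_2) (z : CP1) : CP1 :=
  let a := g ord0 ord0 in let b := g ord0 ord_max in
  let c := g ord_max ord0 in let d := g ord_max ord_max in
  match z with
  | Some w => if c * w + d == 0 then None else Some ((a * w + b) / (c * w + d))
  | None => if c == 0 then None else Some (a / c)
  end.

Definition act (g : 'M[C]_2) (f : CP1 -> C) : CP1 -> C :=
  fun z => f (mobius (invmx g) z).

(* continuity on CP^1: in the chart z on C and in the chart w = 1/z near ∞ *)
Definition chart_inf (w : C) : CP1 := if w == 0 then None else Some w^-1.

Definition continuous_CP1 (f : CP1 -> C) : Prop :=
  continuous ((fun w : Ctop => (f (Some w) : Ctop))) /\
  ((fun w : Ctop => (f (chart_inf w) : Ctop)) x @[x --> (0 : Ctop)] -->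
     (f None : Ctop)).

Definition is_subspace (V : set (CP1 -> C)) : Prop :=
  V (fun _ => 0) /\
  (forall f h, V f -> V h -> V (fun z => f z + h z)) /\
  (forall (c : C) f, V f -> V (fun z => c * f z)).

Definition SU2_invariant (V : set (CP1 -> C)) : Prop :=
  forall g, SU2 g -> forall f, V f -> V (act g f).

Definition has_dim (V : set (CP1 -> C)) (n : nat) : Prop :=
  exists b : 'I_n -> CP1 -> C,
    (forall i, V (b i)) /\
    (forall c : 'I_n -> C, (forall z, \sum_(i < n) c i * b i z = 0) ->
        forall i, c i = 0) /\
    (forall f, V f -> exists c : 'I_n -> C,
        forall z, f z = \sum_(i < n) c i * b i z).

Definition SU2_irreducible (V : set (CP1 -> C)) : Prop :=
  (exists f, V f /\ f <> (fun _ => 0)) /\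
  forall W, is_subspace W -> SU2_invariant W -> W `<=` V ->
    W = [set (fun _ => 0)] \/ W = V.

(* V is an irreducible SU(2)-invariant subspace of dimension 2m+1 of
   continuous functions on CP^1, i.e. V is \widetilde{H_{2m}} *)
Definition is_Htilde (m : nat) (V : set (CP1 -> C)) : Prop :=
  is_subspace V /\ SU2_invariant V /\ SU2_irreducible V /\
  has_dim V (m.*2.+1) /\ (forall f, V f -> continuous_CP1 f).

Definition reC (z : C) : R := let: a +i* _ := z in a.
Definition imC (z : C) : R := let: _ +i* b := z in b.
Definition sqn (z : C) : R := reC z ^+ 2 + imC z ^+ 2.

Definition leb2 := (@lebesgue_measure R \x @lebesgue_measure R)%E.
Definition toC (p : R * R) : C := p.1 +i* p.2.

Definition cint (F : C -> C) : C :=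
  (Rintegral leb2 setT (fun p => reC (F (toC p)))) +i*
  (Rintegral leb2 setT (fun p => imC (F (toC p)))).

Definition iota_density (s : C) : R := 1 / (pi * (1 + sqn s) ^+ 2).

Definition berezin_kernel (tau : nat) (z s : C) : R :=
  sqn (1 + z * conjc s) ^+ tau / ((1 + sqn z) ^+ tau * (1 + sqn s) ^+ tau).

Definition Berezin (tau : nat) (f : CP1 -> C) (z : C) : C :=
  cint (fun s => (berezin_kernel tau z s * iota_density s)%:C * f (Some s)).

Definition Eop (mu k : nat) (f : CP1 -> C) (z : C) : C :=
  ('C(mu, k))%:R * \sum_(l < k.+1)
     ((-1) ^+ (k - l) * ('C(k, l))%:R * Berezin (mu - l) f z).

Definition poch (a : R) (l : nat) : R := \prod_(i < l) (a + i%:R).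

(* 3F2(-k, a2, a3; b1, b2; 1), terminating at l = k *)
Definition F32_term (k : nat) (a2 a3 b1 b2 : R) (l : nat) : R :=
  poch (- k%:R) l * poch a2 l * poch a3 l / (poch b1 l * poch b2 l * (l`!)%:R).

Definition F32 (k : nat) (a2 a3 b1 b2 : R) : R :=
  \sum_(l < k.+1) F32_term k a2 a3 b1 b2 l.

Definition E_eigen (mu k m : nat) : R :=
  (-1) ^+ k * ('C(mu, k))%:R * ((mu`!)%:R) ^+ 2 *
  F32 k (- (m + mu + 1)%:R) (m%:R - mu%:R) (- mu%:R) (- mu%:R) /
  (((mu - m)`!)%:R * ((mu + m + 1)`!)%:R).

End Defs.

(* Main.v *)
(* The kernel |1 + z conj(s)|^2 / ((1 + |z|^2)(1 + |s|^2)) of the Berezin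
   transforms B_t is SU(2)-invariant, and B_i and B_j commute by symmetry.  Let
   V be irreducible and j minimal with B_j nonzero on V; such a j exists because
   (t + 1) B_t is an approximate identity.  By irreducibility B_j is injective
   on V.  Averaging f in V over finitely many rotations about 0 makes B_j f a
   polynomial of degree at most j in y = 1 / (1 + |z|^2), which is distributed
   uniformly on [0, 1]; it is orthogonal to y^i for i < j because B_i kills V,
   hence it is a multiple of the shifted Legendre polynomial P_j.  So B_j is
   scalar on V, P_j(y) is a zonal function of V, and B_t acts on V by
   int_0^1 y^t P_j(y) dy, which is (t!)^2 / ((t - j)! (t + j + 1)!) for t >= j and
   0 for t < j.  The zonal function also gives the reproducing kernel of V, whose
   trace is dim V = 2 j + 1, so j = m.  The hypergeometric sum is the resulting
   alternating sum. *)

Require Import Defs.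
From HB Require Import structures.
From mathcomp Require Import all_boot all_order all_algebra.
From mathcomp Require Import all_classical all_reals all_analysis.
From mathcomp Require Import measurable_realfun complex.
From mathcomp Require Import separable cyclic cyclotomic.
From mathcomp Require Import ring lra zify.
Import ComplexField.
Import Order.TTheory GRing.Theory Num.Theory.
Import numFieldNormedType.Exports.
Set Implicit Arguments.
Unset Strict Implicit.
Unset Printing Implicit Defensive.
Local Open Scope ring_scope.
Local Open Scope classical_set_scope.
Local Open Scope complex_scope.

(** Three obstacles shape the proof. Möbius maps are not affine, so the change of variables for iota
    is done on C^2, where SU(2) is linear and every matrix of determinant 1 is a product of shears;
    on slices a shear is a translation. No integral over the group or over a circle is taken. The
    kernel power [ker ^+ j] has finite rank, its coefficients have rotation weights 2(a - b) with |a
    - b| <= j, and j + 1 rotations already remove all nonzero weights. The same expansion replaces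
    Fubini when two transforms are composed, and yields the distribution of y without polar
    coordinates. V is given abstractly, so no explicit spherical harmonics are at hand. That B_j is
    scalar comes from two linear functionals on V, the values of f and of B_j f at 0: the kernel of
    the second lies in that of the first, so they are proportional, and transitivity of SU(2)
    carries this to every point. Finally, m enters only as a dimension while j comes from analysis,
    and the trace is what ties them together. *)

(** * Affine changes of variables for Lebesgue measure on the line and the plane *)

Section Affine.
Context {R : realType}.
Local Notation mu := (@lebesgue_measure R).

Lemma measurable_affine (a b : R) : measurable_fun setT (fun x : R => a * x + b).
Proof.
by apply: measurable_funD => //; apply: measurable_funM.
Qed.

(** Inversion is discontinuous at 0, where its value is 0 by convention, so the point 0 is split
    off. *)
Lemma measurable_invr : measurable_fun setT (@GRing.inv R).
Proof.
rewrite -(setvU [set (0 : R)]); apply/measurable_funU => //.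
  exact: measurableC.
split.
  apply: open_continuous_measurable_fun.
    by apply: closed_openC; exact: closed_eq.
  by move=> x; rewrite inE /= => /eqP x0; exact: inv_continuous.
exact: measurable_fun_set1.
Qed.

(** By uniqueness of Lebesgue measure it suffices that |a| times the pushforward of [mu] under x ->
    a x + b agrees with [mu] on intervals ]x, y]. For a < 0 the preimage is half-open on the other
    side, whence the two cases. *)
Lemma integral_affine (a b : R) (f : R -> \bar R) : a != 0 ->
  measurable_fun setT f -> (forall x, 0 <= f x)%E ->
  (\int[mu]_x f x = `|a|%:E * \int[mu]_x f (a * x + b)%R)%E.
Proof.
move=> a0 mf f0.
have a1 : (0 < `|a|)%R by rewrite normr_gt0.
pose k : {nonneg R} := NngNum (ltW a1).
pose h : measurableTypeR R -> measurableTypeR R := fun x : R => a * x + b.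
have mh : @measurable_fun _ _ (measurableTypeR R) (measurableTypeR R) setT h.
  exact: measurable_affine.
pose m' : {measure set (measurableTypeR R) -> \bar R} :=
  mscale k (measure_function_pushforward__canonical__measure_function_Measure mu mh).
rewrite (eq_measure_integral m'); last first.
  move=> A mA _; apply: (lebesgue_measure_unique (mu := m')) => //.
  move=> _ [[x y] _ <-].
  have E (t : R) : (a * t + b \in `]x, y]%R) =
      (t \in if 0 < a then `](x - b) / a, (y - b) / a]%R
              else `[(y - b) / a, (x - b) / a[%R).
    have [a_gt0|a_le0] := ltP 0 a; rewrite !in_itv /=.
      by rewrite ltr_pdivrMr // ler_pdivlMr // ltrBlDr lerBrDr (mulrC t).
    have an : a < 0 by rewrite lt_neqAle a0.
    by rewrite ltr_ndivlMr // ler_ndivrMr // ltrBlDr lerBrDr (mulrC t) andbC.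
  rewrite /m' /mscale /pushforward /=.
  rewrite [X in _ = (_ * lebesgue_measure X)%E](_ : _ = [set` (if 0 < a
      then `](x - b) / a, (y - b) / a]%R else `[(y - b) / a, (x - b) / a[%R)]); last first.
    by apply/seteqP; split => t /=; have := E t; rewrite /h => ->.
  have [a_gt0|a_le0] := ltP 0 a; rewrite !lebesgue_measure_itv /= !lte_fin.
    rewrite ltr_pM2r ?invr_gt0 // ltrD2r; case: ifP => _; last by rewrite mule0.
    by rewrite -!EFinB -EFinM; congr EFin; rewrite gtr0_norm //; field; lra.
  have an : a < 0 by rewrite lt_neqAle a0.
  rewrite ltr_nM2r ?invr_lt0 // ltrD2r; case: ifP => _; last by rewrite mule0.
  by rewrite -!EFinB -EFinM; congr EFin; rewrite ltr0_norm //; field; lra.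
rewrite /m' ge0_integral_mscale // ge0_integral_pushforward //.
Qed.

Local Notation leb2 := (mu \x mu)%E.
Local Notation RR := (measurableTypeR R * measurableTypeR R)%type.

(** The offset may be any measurable function of the other coordinate, since it is constant on each
    slice; this covers shears. *)
Lemma leb2_affine1 (a : R) (b : R -> R) (f : RR -> \bar R) : a != 0 ->
  measurable_fun setT b -> measurable_fun setT f -> (forall p, 0 <= f p)%E ->
  (\int[leb2]_p f p = `|a|%:E * \int[leb2]_p f (a * p.1 + b p.2, p.2)%R)%E.
Proof.
move=> a0 mb mf f0.
have mg : measurable_fun setT (fun p : RR => f (a * p.1 + b p.2, p.2)%R).
  apply: (measurableT_comp mf); apply: measurable_fun_pair => //.
  apply: measurable_funD; first exact: measurable_funM.
  exact: measurableT_comp.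
rewrite fubini_tonelli2 // fubini_tonelli2 //.
rewrite -ge0_integralZl //; last 2 first.
- exact: measurable_fun_fubini_tonelli_G.
- by move=> y _; exact: integral_ge0.
apply: eq_integral => y _; rewrite /fubini_G /=.
rewrite (integral_affine (b y) a0) //.
exact: measurable_fun_pair1.
Qed.

Lemma leb2_affine2 (a : R) (b : R -> R) (f : RR -> \bar R) : a != 0 ->
  measurable_fun setT b -> measurable_fun setT f -> (forall p, 0 <= f p)%E ->
  (\int[leb2]_p f p = `|a|%:E * \int[leb2]_p f (p.1, a * p.2 + b p.1)%R)%E.
Proof.
move=> a0 mb mf f0.
have mg : measurable_fun setT (fun p : RR => f (p.1, a * p.2 + b p.1)%R).
  apply: (measurableT_comp mf); apply: measurable_fun_pair => //.
  apply: measurable_funD; first exact: measurable_funM.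
  exact: measurableT_comp.
rewrite fubini_tonelli1 // fubini_tonelli1 //.
rewrite -ge0_integralZl //; last 2 first.
- exact: measurable_fun_fubini_tonelli_F.
- by move=> y _; exact: integral_ge0.
apply: eq_integral => y _; rewrite /fubini_F /=.
rewrite (integral_affine (b y) a0) //.
exact: measurable_fun_pair2.
Qed.

End Affine.

(** * The total mass of iota *)

Section Base.
Context {R : realType}.
Local Notation mu := (@lebesgue_measure R).

Lemma oneDsqr_gt0 (x : R) : 0 < 1 + x ^+ 2.
Proof. by rewrite ltr_pwDl // sqr_ge0. Qed.

Lemma continuous_oneDsqrVX n : continuous (fun x : R => (1 + x ^+ 2) ^- n).
Proof.
move=> x; apply: (@cvgV _ _ _ _ (fun x : R => (1 + x ^+ 2) ^+ n)).
  by rewrite expf_neq0 // gt_eqF // oneDsqr_gt0.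
apply: (@continuous_comp _ _ _ (fun x : R => 1 + x ^+ 2) (fun x : R => x ^+ n)).
  by apply: cvgD; [exact: cvg_cst|exact: exprn_continuous].
exact: exprn_continuous.
Qed.

Lemma continuous_sqrtD1 : continuous (fun x : R => Num.sqrt (1 + x ^+ 2)).
Proof.
move=> x; apply: (@continuous_comp _ _ _ (fun x : R => 1 + x ^+ 2) Num.sqrt).
  by apply: cvgD; [exact: cvg_cst|exact: exprn_continuous].
exact: sqrt_continuous.
Qed.

Lemma continuous_sqrtD1V n : continuous (fun x : R => (Num.sqrt (1 + x ^+ 2)) ^- n).
Proof.
move=> x; apply: (@cvgV _ _ _ _ (fun x : R => (Num.sqrt (1 + x ^+ 2)) ^+ n)).
  by rewrite expf_neq0 // gt_eqF // sqrtr_gt0 oneDsqr_gt0.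
apply: (@continuous_comp _ _ _ (fun x : R => Num.sqrt (1 + x ^+ 2)) (fun x : R => x ^+ n)).
  exact: continuous_sqrtD1.
exact: exprn_continuous.
Qed.

Lemma cvgy_inv_oneDsqr : (fun x : R => x / (1 + x ^+ 2)) x @[x --> +oo] --> (0 : R).
Proof.
apply: (@squeeze_cvgr _ _ _ _ (fun=> 0) (fun x : R => x^-1)).
- near=> x; have x0 : 0 < x by near: x; exact: nbhs_pinfty_gt.
  rewrite divr_ge0 ?ltW ?oneDsqr_gt0 //=.
  rewrite ltr_pdivrMr ?oneDsqr_gt0 // mulrDr mulr1 expr2 mulKf ?gt_eqF //.
  by rewrite ltrDr invr_gt0.
- exact: cvg_cst.
- by apply/gtr0_cvgV0 => //; exact: nbhs_pinfty_gt.
Unshelve. all: by end_near. Qed.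

Lemma cvgy_div_sqrt : (fun x : R => x / Num.sqrt (1 + x ^+ 2)) x @[x --> +oo] --> (1 : R).
Proof.
apply: (@squeeze_cvgr _ _ _ _ (fun x : R => 1 - x^-1) (fun=> 1)).
- near=> x; have x0 : 0 < x by near: x; exact: nbhs_pinfty_gt.
  have s0 : 0 < Num.sqrt (1 + x ^+ 2) by rewrite sqrtr_gt0 oneDsqr_gt0.
  have sx : x <= Num.sqrt (1 + x ^+ 2).
    by rewrite -{1}(ger0_norm (ltW x0)) -sqrtr_sqr ler_sqrt ?lerDr // ltW ?oneDsqr_gt0.
  have sx1 : Num.sqrt (1 + x ^+ 2) <= x + 1.
    rewrite -[x + 1]ger0_norm ?addr_ge0 ?(ltW x0) // -sqrtr_sqr ler_sqrt ?sqr_ge0 //.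
    by rewrite sqrrD mulr1 expr1n addrC lerD2r lerDl mulrn_wge0 // ltW.
  rewrite ler_pdivrMr // mul1r sx andbT ler_pdivlMr //.
  rewrite mulrBl mul1r lerBlDr (le_trans sx1) // lerD2l.
  by rewrite mulrC ler_pdivlMr // mul1r.
- rewrite -[X in _ --> X]subr0; apply: cvgB; first exact: cvg_cst.
  by apply/gtr0_cvgV0 => //; exact: nbhs_pinfty_gt.
- exact: cvg_cst.
Unshelve. all: by end_near. Qed.

Lemma integral_oneDsqrV2 : (\int[mu]_x ((1 + x ^+ 2) ^- 2)%:E = (pi / 2)%:E)%E.
Proof.
rewrite ge0_symfun_integralT; last 3 first.
- by move=> x; rewrite invr_ge0 exprn_ge0 // ltW // oneDsqr_gt0.
- exact: continuous_oneDsqrVX.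
- by move=> x /=; rewrite sqrrN.
pose F (x : R) := 2^-1 * (x / (1 + x ^+ 2) + atan x).
have dF (x : R) : is_derive x 1 F ((1 + x ^+ 2) ^- 2).
  have n0 : 1 + x ^+ 2 != 0 by rewrite gt_eqF // oneDsqr_gt0.
  have h1 : is_derive x 1 (fun x : R => (1 + x ^+ 2)^-1) (- (1 + x ^+ 2) ^- 2 *: (0 + 2%:R * x ^+ 1 *: 1)).
    apply: is_deriveV => //.
    by apply: is_derive_eq; rewrite /GRing.scale /=; ring.
  apply: is_derive_eq.
  rewrite /GRing.scale /=; field; done.
rewrite -set_itvcy (@ge0_continuous_FTC2y _ _ F 0 (pi / 4)) //.
- rewrite /F atan0 mul0r add0r mulr0 sube0 -EFinM; congr EFin; by field.
- by move=> x _; rewrite invr_ge0 exprn_ge0 // ltW // oneDsqr_gt0.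
- by apply: continuous_subspaceT; exact: continuous_oneDsqrVX.
- rewrite (_ : pi / 4 = 2^-1 * (0 + pi / 2)); last by field.
  by apply: cvgM; [exact: cvg_cst|apply: cvgD; [exact: cvgy_inv_oneDsqr|exact: cvgy_atan]].
- apply: cvg_at_right_filter; apply: differentiable_continuous.
  by apply/derivable1_diffP; apply: ex_derive.
- by move=> x _; rewrite derive1E; apply: derive_val.
Qed.

Lemma integral_sqrtD1V3 : (\int[mu]_x ((Num.sqrt (1 + x ^+ 2)) ^- 3)%:E = 2%:E)%E.
Proof.
rewrite ge0_symfun_integralT; last 3 first.
- by move=> x; rewrite invr_ge0 exprn_ge0 // sqrtr_ge0.
- exact: continuous_sqrtD1V.
- by move=> x /=; rewrite sqrrN.
pose F (x : R) := x / Num.sqrt (1 + x ^+ 2).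
have dF (x : R) : is_derive x 1 F ((Num.sqrt (1 + x ^+ 2)) ^- 3).
  have p0 := oneDsqr_gt0 x.
  have s0 : 0 < Num.sqrt (1 + x ^+ 2) by rewrite sqrtr_gt0.
  have h0 : is_derive x 1 (Num.sqrt \o (fun x : R => 1 + x ^+ 2))
     ((2 * Num.sqrt (1 + x ^+ 2))^-1 * (0 + 2%:R * x ^+ 1 *: 1)).
    apply: is_derive1_comp; first exact: is_derive1_sqrt.
    by apply: is_derive_eq; rewrite /GRing.scale /=; ring.
  have h1 := @is_deriveV _ (Num.sqrt \o (fun x => 1 + x ^+ 2)) x _ 1 (lt0r_neq0 s0) h0.
  apply: is_derive_eq.
  rewrite /GRing.scale /=.
  have e := sqr_sqrtr (ltW p0).
  move: (Num.sqrt (1 + x ^+ 2)) s0 e => s s0 e.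
  have x2 : x ^+ 2 = s ^+ 2 - 1 by rewrite e; ring.
  have -> : x * (- s ^- 2 * ((2 * s)^-1 * (0 + 2 * x ^+ 1 * 1))) = - x ^+ 2 * s ^- 3.
    field; lra.
  rewrite x2; field; lra.
rewrite -set_itvcy (@ge0_continuous_FTC2y _ _ F 0 1) //.
- by rewrite /F mul0r sube0 -EFinM mulr1.
- by apply: continuous_subspaceT; exact: continuous_sqrtD1V.
- exact: cvgy_div_sqrt.
- apply: cvg_at_right_filter; apply: differentiable_continuous.
  by apply/derivable1_diffP; apply: ex_derive.
- by move=> x _; rewrite derive1E; apply: derive_val.
Qed.

(** With s = sqrt(1 + x^2), the substitution y -> s y turns the inner integral into s * s^-4 * pi /
    2, and s^-3 has integral 2 over the line. *)
Lemma leb2_oneDsqrV2 :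
  (\int[mu \x mu]_p ((1 + (p.1 ^+ 2 + p.2 ^+ 2)) ^- 2)%:E = pi%:E)%E.
Proof.
rewrite fubini_tonelli1; last 2 first.
- apply/measurable_EFinP; apply: (measurableT_comp (@measurable_invr R)).
  apply: measurable_funX; apply: measurable_funD => //.
  by apply: measurable_funD; apply: measurable_funX.
- by move=> p; rewrite lee_fin invr_ge0 exprn_ge0 // !addr_ge0 // sqr_ge0.
transitivity (\int[mu]_x ((pi / 2)%:E * (Num.sqrt (1 + x ^+ 2) ^- 3)%:E))%E.
  apply: eq_integral => x _; rewrite /fubini_F /=.
  have p0 := oneDsqr_gt0 x.
  have s0 : 0 < Num.sqrt (1 + x ^+ 2) by rewrite sqrtr_gt0.
  have e := sqr_sqrtr (ltW p0).
  rewrite (@integral_affine _ (Num.sqrt (1 + x ^+ 2)) 0) ?gt_eqF //; last 2 first.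
  - apply/measurable_EFinP; apply: (measurableT_comp (@measurable_invr R)).
    apply: measurable_funX; apply: measurable_funD => //.
    by apply: measurable_funD; apply: measurable_funX.
  - by move=> y; rewrite lee_fin invr_ge0 exprn_ge0 // !addr_ge0 // sqr_ge0.
  rewrite ger0_norm ?ltW //.
  transitivity ((Num.sqrt (1 + x ^+ 2))%:E * \int[mu]_y (((1 + x ^+ 2) ^- 2)%:E * ((1 + y ^+ 2) ^- 2)%:E))%E.
    congr (_ * _)%E; apply: eq_integral => y _; rewrite -EFinM; congr EFin.
    rewrite addr0 exprMn e -invfM -exprMn; congr (_ ^- 2); ring.
  rewrite ge0_integralZl //; last 3 first.
  - apply/measurable_EFinP; apply: continuous_measurable_fun; exact: continuous_oneDsqrVX.
  - by move=> y _; rewrite lee_fin invr_ge0 exprn_ge0 // ltW // oneDsqr_gt0.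
  - by rewrite lee_fin invr_ge0 exprn_ge0 // ltW.
  rewrite integral_oneDsqrV2 -!EFinM; congr EFin.
  rewrite -[in X in _ * (X * _)]e; move: (Num.sqrt _) s0 => s s0; field; lra.
rewrite ge0_integralZl //; last 2 first.
- apply/measurable_EFinP; apply: continuous_measurable_fun.
  exact: continuous_sqrtD1V.
- by rewrite lee_fin divr_ge0 // pi_ge0.
by rewrite integral_sqrtD1V3 -EFinM divfK.
Qed.

End Base.

(** * Comparison of double integrals slice by slice *)

Section Shear.
Local Open Scope ereal_scope.
Context d1 d2 (T1 : measurableType d1) (T2 : measurableType d2) (R : realType).
Context (m1 : {sigma_finite_measure set T1 -> \bar R}).
Context (m2 : {sigma_finite_measure set T2 -> \bar R}).

Lemma integral_shear1 (F G : T1 * T2 -> \bar R) :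
  measurable_fun setT F -> measurable_fun setT G ->
  (forall p, 0 <= F p) -> (forall p, 0 <= G p) ->
  (forall y, \int[m1]_x F (x, y) = \int[m1]_x G (x, y)) ->
  \int[m1 \x m2]_p F p = \int[m1 \x m2]_p G p.
Proof.
move=> mF mG F0 G0 FG; rewrite (fubini_tonelli2 F mF F0) (fubini_tonelli2 G mG G0).
by apply: eq_integral => y _; exact: FG.
Qed.

Lemma integral_shear2 (F G : T1 * T2 -> \bar R) :
  measurable_fun setT F -> measurable_fun setT G ->
  (forall p, 0 <= F p) -> (forall p, 0 <= G p) ->
  (forall x, \int[m2]_y F (x, y) = \int[m2]_y G (x, y)) ->
  \int[m1 \x m2]_p F p = \int[m1 \x m2]_p G p.
Proof.
move=> mF mG F0 G0 FG; rewrite (fubini_tonelli1 F mF F0) (fubini_tonelli1 G mG G0).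
by apply: eq_integral => y _; exact: FG.
Qed.

End Shear.

(** * Linear substitutions on C and C^2 in real coordinates *)

Section Complex.
Context {R : realType}.
Local Notation mu := (@lebesgue_measure R).
Local Notation leb2 := (mu \x mu)%E.
Local Notation RR := (measurableTypeR R * measurableTypeR R)%type.
Local Notation C := R[i].

Definition cmul (v p : RR) : RR :=
  (v.1 * p.1 - v.2 * p.2, v.2 * p.1 + v.1 * p.2).
Definition cadd (v p : RR) : RR := (v.1 + p.1, v.2 + p.2).
Definition sqnp (p : RR) : R := p.1 ^+ 2 + p.2 ^+ 2.

Lemma sqnp_ge0 p : 0 <= sqnp p.
Proof. by rewrite addr_ge0 // sqr_ge0. Qed.

Lemma sqnp_eq0 p : (sqnp p == 0) = (p == (0, 0)).
Proof. by case: p => x y; rewrite paddr_eq0 ?sqr_ge0 // !sqrf_eq0. Qed.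

Lemma measurable_sqnp d (T : measurableType d) (f : T -> RR) :
  measurable_fun setT f -> measurable_fun setT (fun x => sqnp (f x)).
Proof.
move=> /measurable_fun_pairP[m1 m2].
by apply: measurable_funD; apply: measurable_funX.
Qed.

Lemma measurable_cmul d (T : measurableType d) (f g : T -> RR) :
  measurable_fun setT f -> measurable_fun setT g ->
  measurable_fun setT (fun x => cmul (f x) (g x)).
Proof.
move=> /measurable_fun_pairP[f1 f2] /measurable_fun_pairP[g1 g2].
apply: measurable_fun_pair.
  by apply: measurable_funB; apply: measurable_funM.
by apply: measurable_funD; apply: measurable_funM.
Qed.

Lemma measurable_cadd d (T : measurableType d) (f g : T -> RR) :
  measurable_fun setT f -> measurable_fun setT g ->
  measurable_fun setT (fun x => cadd (f x) (g x)).
Proof.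
move=> /measurable_fun_pairP[f1 f2] /measurable_fun_pairP[g1 g2].
by apply: measurable_fun_pair; apply: measurable_funD.
Qed.

Lemma leb2_cadd (b : RR) (f : RR -> \bar R) :
  measurable_fun setT f -> (forall p, 0 <= f p)%E ->
  (\int[leb2]_p f p = \int[leb2]_p f (cadd p b))%E.
Proof.
move=> mf f0.
rewrite (leb2_affine1 (a := 1) (b := cst b.1)) // normr1 mul1e.
rewrite (leb2_affine2 (a := 1) (b := cst b.2)) // ?normr1 ?mul1e.
  by apply: eq_integral => p _; rewrite /cadd /= !mul1r.
apply: (measurableT_comp mf); apply: measurable_fun_pair => //.
by apply: measurable_funD => //; apply: measurable_funM.
Qed.

(** Multiplication by v is the real matrix (v1, -v2; v2, v1). For v1 != 0 it factors into two
    triangular maps with scalings v1 and |v|^2 / v1, whose product is the Jacobian |v|^2. *)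
Let leb2_cmul_re (v : RR) (f : RR -> \bar R) : v.1 != 0 ->
  measurable_fun setT f -> (forall p, 0 <= f p)%E ->
  (\int[leb2]_p f p = (sqnp v)%:E * \int[leb2]_p f (cmul v p))%E.
Proof.
move=> v1 mf f0.
have D0 : sqnp v / v.1 != 0.
  rewrite mulf_neq0 ?invr_eq0 // sqnp_eq0; apply: contra v1 => /eqP ->.
  by rewrite eqxx.
rewrite (leb2_affine2 (a := sqnp v / v.1) (b := fun x => v.2 / v.1 * x)) //; last first.
  exact: measurable_funM.
rewrite (leb2_affine1 (a := v.1) (b := fun y => - v.2 * y)) //; last 2 first.
- exact: measurable_funM.
- apply: (measurableT_comp mf); apply: measurable_fun_pair => //.
  by apply: measurable_funD => //; apply: measurable_funM => //; apply: measurable_funM.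
rewrite muleA -EFinM -normrM divfK // ger0_norm ?sqnp_ge0 //.
congr (_ * _)%E; apply: eq_integral => p _; congr (f (_, _)) => /=.
  by rewrite mulNr.
by rewrite /sqnp; field.
Qed.

Lemma leb2_cmul (v : RR) (f : RR -> \bar R) : v != (0, 0) ->
  measurable_fun setT f -> (forall p, 0 <= f p)%E ->
  (\int[leb2]_p f p = (sqnp v)%:E * \int[leb2]_p f (cmul v p))%E.
Proof.
move=> v0 mf f0; have [v10|v1] := eqVneq v.1 0; last exact: leb2_cmul_re.
have v2 : v.2 != 0.
  by apply: contra v0; case: v v10 => /= a b -> /eqP ->.
(* 1 + i has nonzero real part and squares to 2i *)
rewrite (@leb2_cmul_re (1, 1)) ?oner_eq0 //.
rewrite (@leb2_cmul_re (v.2 / 2, v.2 / 2)) ?mulf_neq0 //=; last first.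
  by apply: (measurableT_comp mf); exact: measurable_cmul.
rewrite muleA -EFinM; congr (_ * _)%E.
  by congr EFin; rewrite /sqnp v10 /=; field.
apply: eq_integral => p _; by congr (f (_, _)); rewrite /= v10; field.
Qed.

Lemma leb2_sigma_finite : sigma_finite setT leb2.
Proof.
have /sigma_finiteP[F [TF ndF Foo]] := sigma_finiteT mu.
exists (fun n => F n `*` F n).
  rewrite -setXTT TF predeqE => -[x y]; split.
    move=> [/= [n _ Fnx] [k _ Gky]]; exists (maxn n k) => //; split.
    - by move: x Fnx; exact/subsetPset/ndF/leq_maxl.
    - by move: y Gky; exact/subsetPset/ndF/leq_maxr.
  by move=> [n _ []/= ? ?]; split; exists n.
move=> k; have [? ?] := Foo k.
split; first exact: measurableX.
by rewrite product_measure1E // lte_mul_pinfty // ge0_fin_numE.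
Qed.

(* the product measure carries no canonical sigma-finite structure *)
Definition leb2s : {sigma_finite_measure set RR -> \bar R} :=
  HB.pack leb2 (Measure_isSigmaFinite.Build _ _ _ leb2 leb2_sigma_finite).

Local Notation leb4 := (leb2s \x leb2s)%E.

Lemma leb2sE (f : RR -> \bar R) : (\int[leb2s]_p f p = \int[leb2]_p f p)%E.
Proof. by []. Qed.

Definition ofC (z : C) : RR := (reC z, imC z).

Lemma toCK : cancel (@toC R) ofC.
Proof. by case. Qed.

Lemma ofCK : cancel ofC (@toC R).
Proof. by case. Qed.

Lemma cmul_ofC z p : cmul (ofC z) p = ofC (z * toC p).
Proof.
case: z => a b; case: p => c d; rewrite /cmul /ofC /=.
by congr pair; rewrite addrC.
Qed.

Lemma cadd_ofC z p : cadd p (ofC z) = ofC (toC p + z).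
Proof. by case: z p => a b []. Qed.

Definition lin4 (a b c d : C) (p : RR * RR) : RR * RR :=
  (ofC (a * toC p.1 + b * toC p.2), ofC (c * toC p.1 + d * toC p.2)).

Lemma lin4E a b c d p : lin4 a b c d p =
  (cadd (cmul (ofC a) p.1) (cmul (ofC b) p.2),
   cadd (cmul (ofC c) p.1) (cmul (ofC d) p.2)).
Proof.
have E (x y : C) : ofC (x * toC p.1 + y * toC p.2) =
    cadd (cmul (ofC x) p.1) (cmul (ofC y) p.2).
  by rewrite [cmul (ofC y) _]cmul_ofC cadd_ofC cmul_ofC ofCK.
by rewrite -!E.
Qed.

Lemma lin4_comp a b c d a' b' c' d' :
  lin4 a b c d \o lin4 a' b' c' d' = lin4 (a * a' + b * c') (a * b' + b * d')
    (c * a' + d * c') (c * b' + d * d').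
Proof.
apply/funext => p; rewrite /lin4 /= !ofCK.
by congr (ofC _, ofC _); rewrite !mulrDr !mulrDl !mulrA addrACA.
Qed.

Lemma measurable_lin4 a b c d : measurable_fun setT (lin4 a b c d).
Proof.
rewrite (funext (lin4E a b c d)); apply: measurable_fun_pair;
  by apply: measurable_cadd; apply: measurable_cmul.
Qed.

Let leb4_shear1 (b : C) (F : RR * RR -> \bar R) :
  measurable_fun setT F -> (forall p, 0 <= F p)%E ->
  (\int[leb4]_p F p = \int[leb4]_p (F \o lin4 1%R b 0%R 1%R) p)%E.
Proof.
move=> mF F0; have mG := measurableT_comp mF (measurable_lin4 1 b 0 1).
have G0 p : (0 <= (F \o lin4 1%R b 0%R 1%R) p)%E by exact: F0.
apply: (@integral_shear1 _ _ _ _ _ leb2s leb2s F _ mF mG F0 G0).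
move=> y; rewrite !leb2sE; have mFy := measurable_fun_pair1 y mF.
rewrite (leb2_cadd (ofC (b * toC y)) mFy (fun x => F0 (x, y))).
apply: eq_integral => x _; rewrite cadd_ofC /lin4 /comp.
by rewrite !mul1r mul0r add0r toCK.
Qed.

Let leb4_shear2 (c : C) (F : RR * RR -> \bar R) :
  measurable_fun setT F -> (forall p, 0 <= F p)%E ->
  (\int[leb4]_p F p = \int[leb4]_p (F \o lin4 1%R 0%R c 1%R) p)%E.
Proof.
move=> mF F0; have mG := measurableT_comp mF (measurable_lin4 1 0 c 1).
have G0 p : (0 <= (F \o lin4 1%R 0%R c 1%R) p)%E by exact: F0.
apply: (@integral_shear2 _ _ _ _ _ leb2s leb2s F _ mF mG F0 G0).
move=> x; rewrite !leb2sE; have mFx := measurable_fun_pair2 x mF.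
rewrite (leb2_cadd (ofC (c * toC x)) mFx (fun y => F0 (x, y))).
apply: eq_integral => y _; rewrite cadd_ofC /lin4 /comp.
by rewrite !mul1r mul0r addr0 toCK addrC.
Qed.

(** For c != 0 the matrix is the product of an upper shear by (a - 1) / c, a lower shear by c and an
    upper shear by (d - 1) / c, each of which preserves volume. *)
Let leb4_SL2_c (a b c d : C) (F : RR * RR -> \bar R) : c != 0 -> a * d - b * c = 1 ->
  measurable_fun setT F -> (forall p, 0 <= F p)%E ->
  (\int[leb4]_p F p = \int[leb4]_p (F \o lin4 a b c d) p)%E.
Proof.
move=> c0 det mF F0.
have m1 := measurableT_comp mF (measurable_lin4 1 ((a - 1) / c) 0 1).
have m2 := measurableT_comp m1 (measurable_lin4 1 0 c 1).
rewrite (leb4_shear1 ((a - 1) / c) mF F0) (leb4_shear2 c m1 (fun p => F0 _)).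
rewrite (leb4_shear1 ((d - 1) / c) m2 (fun p => F0 _)).
rewrite -[_ \o _ \o lin4 _ _ _ _]compA -compA !lin4_comp.
have -> : b = (a * d - 1) / c by rewrite -det opprB addrCA subrr addr0 mulfK.
have -> : 1 * (1 * ((d - 1) / c) + 0 * 1) + (a - 1) / c * (c * ((d - 1) / c) + 1 * 1) = (a * d - 1) / c.
  by field.
rewrite !(mul1r, mulr1, mul0r, mulr0, add0r, addr0) divfK // addrC subrK.
by rewrite mulrCA mulfV // mulr1 subrK.
Qed.

(** If c = 0, splitting off the quarter turn (0, -1; 1, 0) leaves a matrix whose lower left entry is
    -d, nonzero because a d = 1. *)
Lemma leb4_SL2 (a b c d : C) (F : RR * RR -> \bar R) : a * d - b * c = 1 ->
  measurable_fun setT F -> (forall p, 0 <= F p)%E ->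
  (\int[leb4]_p F p = \int[leb4]_p (F \o lin4 a b c d) p)%E.
Proof.
move=> det mF F0; have [c0|c0] := eqVneq c 0; last exact: leb4_SL2_c.
have d0 : d != 0.
  apply/eqP => d0; move/eqP: det; rewrite c0 d0 !mulr0 subr0 eq_sym.
  by rewrite oner_eq0.
have nd0 : - d != 0 by rewrite oppr_eq0.
have e0 : - b * c - a * - d = 1 by rewrite -det mulrN opprK mulNr addrC.
rewrite (leb4_SL2_c nd0 e0 mF F0).
have e : 0 * 0 - -1 * 1 = 1 :> C by rewrite mul0r mulN1r opprK add0r.
have m : measurable_fun setT (F \o lin4 (- b) a (- d) c).
  exact: (measurableT_comp mF (measurable_lin4 _ _ _ _)).
rewrite (leb4_SL2_c (oner_neq0 C) e m (fun p => F0 _)).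
rewrite -compA lin4_comp.
by rewrite !(mulrN1, opprK, mulr0, mulr1, add0r, addr0).
Qed.

End Complex.

Lemma det2E (K : comNzRingType) (g : 'M[K]_2) : \det g =
  g ord0 ord0 * g ord_max ord_max - g ord0 ord_max * g ord_max ord0.
Proof.
rewrite (expand_det_row _ ord0) big_ord_recl big_ord1 /cofactor !det_mx11 !mxE.
rewrite /= expr0 expr1 mul1r mulN1r mulrN.
by congr (_ * g _ _ - g _ _ * g _ _); exact/val_inj.
Qed.

(** * Invariance of iota

    A function f on CP^1 is integrated over C^2 against a radial weight; the
    linear action of SU(2) on C^2 preserves volume and norm, and (u, v) = (s v, v)
    separates the integral into that of f over iota and a constant. *)

Section Invariance.
Context {R : realType}.
Local Notation mu := (@lebesgue_measure R).
Local Notation leb2 := (mu \x mu)%E.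
Local Notation RR := (measurableTypeR R * measurableTypeR R)%type.
Local Notation C := R[i].
Local Notation leb2s := (@leb2s R).
Local Notation leb4 := (leb2s \x leb2s)%E.

Definition pt (u v : C) : CP1 R := if v == 0 then None else Some (u / v).

Lemma mobius_pt (g : 'M[C]_2) u v : \det g != 0 -> (u, v) != (0, 0) ->
  mobius g (pt u v) = pt (g ord0 ord0 * u + g ord0 ord_max * v)
                         (g ord_max ord0 * u + g ord_max ord_max * v).
Proof.
rewrite det2E => dg uv0.
set a := g ord0 ord0; set b := g ord0 ord_max.
set c := g ord_max ord0; set d := g ord_max ord_max.
rewrite /pt; have [v0|v0] := eqVneq v 0.
  have u0 : u != 0 by apply: contra uv0 => /eqP ->; rewrite v0.
  rewrite v0 !mulr0 !addr0 /mobius -/a -/c mulf_eq0 (negbTE u0) orbF.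
  by case: eqVneq => // c0; rewrite invfM mulrACA mulfV // mulr1.
rewrite /mobius -/a -/b -/c -/d.
have e : c * u + d * v = (c * (u / v) + d) * v by rewrite mulrDl -mulrA divfK.
rewrite e mulf_eq0 (negbTE v0) orbF; case: eqVneq => // h.
have -> : a * u + b * v = (a * (u / v) + b) * v by rewrite mulrDl -mulrA divfK.
by rewrite -mulf_div divff // mulr1.
Qed.

Lemma pt_toC (u v : RR) : pt (toC u) (toC v) =
  if sqnp v == 0 then None else
  Some (toC ((u.1 * v.1 + u.2 * v.2) / sqnp v, (u.2 * v.1 - u.1 * v.2) / sqnp v)).
Proof.
rewrite /pt sqnp_eq0; case: u v => [u1 u2] [v1 v2].
have -> : (toC (v1, v2) == 0) = ((v1, v2) == (0, 0)).
  by rewrite eq_complex.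
case: ifPn => // v0; congr Some; rewrite /toC /= /sqnp /=.
have n0 : v1 ^+ 2 + v2 ^+ 2 != 0 by move: v0; rewrite -sqnp_eq0.
by congr (_ +i* _); field.
Qed.

Lemma measurable_pt (f : CP1 R -> R) :
  measurable_fun setT (fun p : RR => f (Some (toC p))) ->
  measurable_fun setT (fun p : RR * RR => f (pt (toC p.1) (toC p.2))).
Proof.
move=> mf.
pose q (p : RR * RR) : RR := ((p.1.1 * p.2.1 + p.1.2 * p.2.2) * (sqnp p.2)^-1,
   (p.1.2 * p.2.1 - p.1.1 * p.2.2) * (sqnp p.2)^-1).
have m11 : measurable_fun setT (fun p : RR * RR => p.1.1) by exact: measurableT_comp.
have m12 : measurable_fun setT (fun p : RR * RR => p.1.2) by exact: measurableT_comp.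
have m21 : measurable_fun setT (fun p : RR * RR => p.2.1) by exact: measurableT_comp.
have m22 : measurable_fun setT (fun p : RR * RR => p.2.2) by exact: measurableT_comp.
have ms : measurable_fun setT (fun p : RR * RR => sqnp p.2) by exact: measurable_sqnp.
have mi : measurable_fun setT (fun p : RR * RR => (sqnp p.2)^-1).
  exact: (measurableT_comp (@measurable_invr R)).
have mq : measurable_fun setT q.
  apply: measurable_fun_pair.
    by apply: measurable_funM => //; apply: measurable_funD; exact: measurable_funM.
  by apply: measurable_funM => //; apply: measurable_funB; exact: measurable_funM.
rewrite (_ : (fun p => _) = fun p => if sqnp p.2 == 0 then f None else f (Some (toC (q p)))); last first.
  by apply/funext => p; rewrite pt_toC; case: ifP.
apply: measurable_fun_ifT => //.
  exact: measurable_fun_eqr.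
exact: (measurableT_comp mf).
Qed.

Definition su2 (a b : C) : 'M[C]_2 :=
  \matrix_(i, j) if i == ord0 then (if j == ord0 then a else b)
                 else (if j == ord0 then - conjc b else conjc a).

Lemma su2E a b : [/\ su2 a b ord0 ord0 = a, su2 a b ord0 ord_max = b,
  su2 a b ord_max ord0 = - conjc b & su2 a b ord_max ord_max = conjc a].
Proof. by rewrite !mxE. Qed.

Lemma mulcJ (z : C) : z * conjc z = (sqn z)%:C.
Proof. by case: z => x y; rewrite /sqn /=; apply/eqP; rewrite eq_complex /=; apply/andP; split; apply/eqP; ring. Qed.

Lemma ord2E (i : 'I_2) : i = ord0 \/ i = ord_max.
Proof. by case: i => -[|[|//]] h; [left|right]; exact/val_inj. Qed.

Lemma SU2P (g : 'M[C]_2) : SU2 g ->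
  exists a b, g = su2 a b /\ sqn a + sqn b = 1.
Proof.
move=> [/matrixP gg]; rewrite det2E.
set a := g ord0 ord0; set b := g ord0 ord_max.
set c := g ord_max ord0; set d := g ord_max ord_max => dg.
have h00 : a * conjc a + b * conjc b = 1.
  have := gg ord0 ord0; rewrite !mxE big_ord_recl big_ord1 !mxE /=.
  by rewrite (_ : lift ord0 ord0 = ord_max :> 'I_2) //; exact/val_inj.
have h10 : c * conjc a + d * conjc b = 0.
  have := gg ord_max ord0; rewrite !mxE big_ord_recl big_ord1 !mxE /=.
  by rewrite (_ : lift ord0 ord0 = ord_max :> 'I_2) //; exact/val_inj.
(* Multiply d by |a|^2 + |b|^2 = 1; orthogonality of the rows turns the result into (a d - b c)
   conj(a). The same is done for c. *)
have dE : d = conjc a.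
  have e : d * conjc b = - (c * conjc a) by apply/eqP; rewrite -addr_eq0 addrC h10.
  rewrite -[d]mulr1 -h00 mulrDr [d * (b * _)]mulrCA e.
  by rewrite mulrN !mulrA -mulrBl [d * a]mulrC dg mul1r.
have cE : c = - conjc b.
  have e : c * conjc a = - (d * conjc b) by apply/eqP; rewrite -addr_eq0 h10.
  rewrite -[c]mulr1 -h00 mulrDr [c * (a * _)]mulrCA e.
  by rewrite mulrN !mulrA addrC -mulrBl -opprB [c * b]mulrC dg mulN1r.
exists a, b; split.
  apply/matrixP => i j; rewrite mxE.
  by have [->|->] := ord2E i; have [->|->] := ord2E j.
by move: h00; rewrite !mulcJ => -[].
Qed.

Lemma det_su2 a b : sqn a + sqn b = 1 -> \det (su2 a b) = 1.
Proof.
move=> h; rewrite det2E.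
have [-> -> -> ->] := su2E a b.
by rewrite mulrN opprK !mulcJ -rmorphD h.
Qed.

Lemma SU2_su2 a b : sqn a + sqn b = 1 -> SU2 (su2 a b).
Proof.
move=> h; split; last exact: det_su2.
have h' : a * conjc a + b * conjc b = 1 by rewrite !mulcJ -rmorphD h.
apply/matrixP => i j; rewrite !mxE big_ord_recl big_ord1.
rewrite (_ : lift ord0 ord0 = ord_max :> 'I_2); last exact/val_inj.
have [->|->] := ord2E i; have [->|->] := ord2E j; rewrite !mxE /=.
- by [].
- by rewrite rmorphN /= !conjcK mulrN [b * _]mulrC addrC subrr.
- by rewrite mulNr [X in _ + X]mulrC addrC subrr.
- by rewrite rmorphN /= !conjcK mulrNN addrC mulrC [X in _ + X]mulrC.
Qed.

Lemma sqnE (z : C) : sqn z = sqnp (ofC z).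
Proof. by case: z. Qed.

Lemma sqnC (z : C) : (sqn z)%:C = z * conjc z.
Proof. by rewrite mulcJ. Qed.

Lemma su2_isometry (a b u v : C) : sqn a + sqn b = 1 ->
  sqn (a * u + b * v) + sqn (- conjc b * u + conjc a * v) = sqn u + sqn v.
Proof.
move=> h; apply: complexI; rewrite [LHS]rmorphD [RHS]rmorphD /= !sqnC.
have e := congr1 (real_complex R) h; rewrite rmorphD /= !sqnC rmorph1 in e.
rewrite !rmorphD !rmorphM /= rmorphN /= !conjcK -[RHS]mul1r -e; ring.
Qed.

(* any positive radial weight with enough decay would do *)
Definition phi (t : R) : R := t / (1 + t) ^+ 4.

Lemma phi_ge0 t : 0 <= t -> 0 <= phi t.
Proof. by move=> t0; rewrite divr_ge0 // exprn_ge0 // addr_ge0. Qed.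

Lemma measurable_phi : measurable_fun setT phi.
Proof.
apply: measurable_funM => //; apply: (measurableT_comp (@measurable_invr R)).
by apply: measurable_funX; apply: measurable_funD.
Qed.

Definition Fphi (f : CP1 R -> R) (p : RR * RR) : \bar R :=
  (f (pt (toC p.1) (toC p.2)) * phi (sqnp p.1 + sqnp p.2))%:E.

Lemma measurable_Fphi (f : CP1 R -> R) :
  measurable_fun setT (fun p : RR => f (Some (toC p))) ->
  measurable_fun setT (Fphi f).
Proof.
move=> mf; apply/measurable_EFinP; apply: measurable_funM.
  exact: measurable_pt.
apply: (measurableT_comp measurable_phi).
by apply: measurable_funD; exact: measurable_sqnp.
Qed.

Lemma Fphi_ge0 (f : CP1 R -> R) : (forall z, 0 <= f z) ->
  forall p, (0 <= Fphi f p)%E.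
Proof.
by move=> f0 p; rewrite lee_fin mulr_ge0 // phi_ge0 // addr_ge0 // sqnp_ge0.
Qed.

Lemma Fphi_mobius (f : CP1 R -> R) a b : sqn a + sqn b = 1 ->
  Fphi f \o lin4 a b (- conjc b) (conjc a) = Fphi (f \o mobius (su2 a b)).
Proof.
move=> h; apply/funext => -[u v]; rewrite /Fphi /lin4 /comp /fst /snd !ofCK -!sqnE.
rewrite su2_isometry // !sqnE !toCK.
(* At the origin [pt] returns infinity, which the Möbius map need not fix; the factor t in [phi]
   makes the integrand vanish there. *)
have [uv|uv] := eqVneq (toC u, toC v) (0, 0).
  have u0 : sqnp u = 0 by rewrite -[u]toCK (congr1 fst uv : toC u = 0) /sqnp /= expr0n addr0.
  have v0 : sqnp v = 0 by rewrite -[v]toCK (congr1 snd uv : toC v = 0) /sqnp /= expr0n addr0.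
  by rewrite u0 v0 /phi addr0 mul0r !mulr0.
rewrite mobius_pt ?det_su2 ?oner_eq0 //.
by have [-> -> -> ->] := su2E a b.
Qed.

Lemma Fphi_invariant (f : CP1 R -> R) g : SU2 g ->
  measurable_fun setT (fun p : RR => f (Some (toC p))) -> (forall z, 0 <= f z) ->
  (\int[leb4]_p Fphi f p = \int[leb4]_p Fphi (f \o mobius g) p)%E.
Proof.
move=> /SU2P[a [b [-> h]]] mf f0.
have det : a * conjc a - b * - conjc b = 1.
  by rewrite mulrN opprK !mulcJ -rmorphD h.
rewrite (leb4_SL2 det (measurable_Fphi mf) (Fphi_ge0 f0)).
by rewrite Fphi_mobius.
Qed.

(** The integrand of [Fphi] after the substitution u = v s: the factor |v|^2 is the Jacobian, and
    |u|^2 + |v|^2 becomes (1 + |s|^2) |v|^2. *)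
Definition H2 (f : CP1 R -> R) (p : RR * RR) : \bar R :=
  (sqnp p.2 * (f (Some (toC p.1)) * phi ((1 + sqnp p.1) * sqnp p.2)))%:E.

Lemma measurable_H2 (f : CP1 R -> R) :
  measurable_fun setT (fun p : RR => f (Some (toC p))) ->
  measurable_fun setT (H2 f).
Proof.
move=> mf; apply/measurable_EFinP.
have m1 : measurable_fun setT (fun p : RR * RR => sqnp p.1) by exact: measurable_sqnp.
have m2 : measurable_fun setT (fun p : RR * RR => sqnp p.2) by exact: measurable_sqnp.
apply: measurable_funM => //; apply: measurable_funM.
  exact: (measurableT_comp mf).
apply: (measurableT_comp measurable_phi).
by apply: measurable_funM => //; apply: measurable_funD.
Qed.

Lemma H2_ge0 (f : CP1 R -> R) : (forall z, 0 <= f z) ->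
  forall p, (0 <= H2 f p)%E.
Proof.
move=> f0 p; rewrite lee_fin; apply: mulr_ge0; first exact: sqnp_ge0.
apply: mulr_ge0 => //; apply: phi_ge0; apply: mulr_ge0; last exact: sqnp_ge0.
by rewrite addr_ge0 // sqnp_ge0.
Qed.

Lemma sqnp_cmul v s : sqnp (cmul v s) = sqnp v * sqnp s :> R.
Proof. by case: v s => [v1 v2] [s1 s2]; rewrite /sqnp /=; ring. Qed.

Lemma leb2_point (p : RR) : leb2 [set p] = 0%E.
Proof.
case: p => x y; rewrite (_ : [set (x, y)] = [set x] `*` [set y]); last first.
  apply/seteqP; split => -[a b] /=; first by case=> -> ->.
  by case=> /= -> ->.
by rewrite product_measure1E //= lebesgue_measure_set1 mul0e.
Qed.

Lemma Fphi_inner (f : CP1 R -> R) (v : RR) :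
  measurable_fun setT (fun p : RR => f (Some (toC p))) -> (forall z, 0 <= f z) ->
  v != (0, 0) ->
  (\int[leb2]_u Fphi f (u, v) = \int[leb2]_s H2 f (s, v))%E.
Proof.
move=> mf f0 v0.
have m1 := measurable_fun_pair1 v (measurable_Fphi mf).
rewrite (leb2_cmul v0 m1 (fun u => Fphi_ge0 f0 (u, v))).
have m2 : measurable_fun setT (fun u => Fphi f (cmul v u, v)).
  apply: (measurableT_comp m1); exact: measurable_cmul.
rewrite -ge0_integralZl; first last.
- by rewrite lee_fin sqnp_ge0.
- by move=> u _; exact: Fphi_ge0.
- exact: m2.
- exact: measurableT.
apply: eq_integral => s _; rewrite /Fphi /H2 /fst /snd -EFinM.
have n0 : toC v != 0.
  by apply: contra v0 => /eqP h; rewrite -[v]toCK h.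
have -> : toC (cmul v s) = toC v * toC s by rewrite -{1}[v]toCK cmul_ofC ofCK.
rewrite /pt (negbTE n0) mulrAC mulfV // mul1r sqnp_cmul.
by congr (_ * (_ * phi _))%:E; ring.
Qed.

Definition cphi : \bar R := (\int[leb2]_w (sqnp w * phi (sqnp w))%:E)%E.

Lemma measurable_cphi : measurable_fun setT (fun w : RR => sqnp w * phi (sqnp w)).
Proof.
have m : measurable_fun setT (fun w : RR => sqnp w) by exact: measurable_sqnp.
by apply: measurable_funM => //; exact: (measurableT_comp measurable_phi).
Qed.

(** Scaling v by (1 + |s|^2)^(-1/2) makes the argument of [phi] free of s. One factor (1 + |s|^2)^-1
    comes from |v|^2 and one from the Jacobian; together they form the density of iota up to 1 /
    pi. *)
Lemma H2_inner (f : CP1 R -> R) (s : RR) :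
  measurable_fun setT (fun p : RR => f (Some (toC p))) -> (forall z, 0 <= f z) ->
  (\int[leb2]_v H2 f (s, v) = cphi * (f (Some (toC s)) * (1 + sqnp s) ^- 2)%:E)%E.
Proof.
move=> mf f0.
have m1 := measurable_fun_pair2 s (measurable_H2 mf).
have A0 : 0 < 1 + sqnp s by rewrite ltr_pwDl // sqnp_ge0.
pose r : RR := (Num.sqrt (1 + sqnp s)^-1, 0).
have sr : sqnp r = (1 + sqnp s)^-1.
  by rewrite /sqnp /= expr0n addr0 sqr_sqrtr // invr_ge0 ltW.
have r0 : r != (0, 0) by rewrite -sqnp_eq0 sr invr_eq0 gt_eqF.
rewrite (leb2_cmul r0 m1 (fun v => H2_ge0 f0 (s, v))).
have e w : H2 f (s, cmul r w) =
    (((1 + sqnp s)^-1 * f (Some (toC s)))%:E * (sqnp w * phi (sqnp w))%:E)%E.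
  rewrite /H2 /fst /snd -EFinM sqnp_cmul sr (mulVKf (lt0r_neq0 A0)).
  by congr EFin; ring.
under eq_integral do rewrite e.
rewrite ge0_integralZl; first last.
- by rewrite lee_fin mulr_ge0 // invr_ge0 ltW.
- by move=> w _; rewrite lee_fin mulr_ge0 ?phi_ge0 ?sqnp_ge0.
- by apply/measurable_EFinP; exact: measurable_cphi.
- exact: measurableT.
rewrite muleA [RHS]muleC; congr (_ * _)%E.
by rewrite sr -EFinM; congr EFin; rewrite mulrA -expr2 exprVn mulrC.
Qed.

Lemma Fphi_total (f : CP1 R -> R) :
  measurable_fun setT (fun p : RR => f (Some (toC p))) -> (forall z, 0 <= f z) ->
  (\int[leb4]_p Fphi f p =
   cphi * \int[leb2]_s (f (Some (toC s)) * (1 + sqnp s) ^- 2)%:E)%E.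
Proof.
move=> mf f0.
have mF := measurable_Fphi mf; have F0 := Fphi_ge0 f0.
have mH := measurable_H2 mf; have H0 := H2_ge0 f0.
rewrite (fubini_tonelli2 (m1 := leb2s) (m2 := leb2s) (Fphi f) mF F0).
transitivity (\int[leb2s]_v \int[leb2s]_s H2 f (s, v))%E.
  (* The substitution u = v s needs v != 0; the excluded slice is over a null set. *)
  apply: ge0_ae_eq_integral.
  - exact: measurableT.
  - exact: (measurable_fun_fubini_tonelli_G (m1 := leb2s) _ mF F0).
  - exact: (measurable_fun_fubini_tonelli_G (m1 := leb2s) _ mH H0).
  - by move=> v _; apply: integral_ge0 => u _; exact: F0.
  - by move=> v _; apply: integral_ge0 => u _; exact: H0.
  exists [set (0, 0)]; split; [|exact: leb2_point|].
    rewrite (_ : [set (0, 0)] = [set 0 : measurableTypeR R] `*` [set 0 : measurableTypeR R]); last first.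
      apply/seteqP; split => -[a b] /=; first by case=> -> ->.
      by case=> /= -> ->.
    by apply: measurableX.
  move=> v /= h; apply: contrapT => /eqP v0; apply: h => _.
  exact: Fphi_inner.
rewrite -(fubini_tonelli (m1 := leb2s) (m2 := leb2s) (H2 f) mH H0).
transitivity (\int[leb2]_s (cphi * (f (Some (toC s)) * (1 + sqnp s) ^- 2)%:E))%E.
  by apply: eq_integral => s _; exact: H2_inner.
rewrite ge0_integralZl //.
- apply/measurable_EFinP; apply: measurable_funM => //.
  apply: (measurableT_comp (@measurable_invr R)); apply: measurable_funX.
  by apply: measurable_funD => //; exact: measurable_sqnp.
- by move=> s _; rewrite lee_fin mulr_ge0 // invr_ge0 exprn_ge0 // addr_ge0 ?sqnp_ge0.
- by apply: integral_ge0 => w _; rewrite lee_fin mulr_ge0 ?phi_ge0 ?sqnp_ge0.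
Qed.

(** Finiteness and positivity of [cphi] allow it to be cancelled when the integrals of f and of its
    translate are compared. Here t^2 / (1 + t)^4 <= (1 + t)^-2. *)
Lemma cphi_lty : (cphi < +oo)%E.
Proof.
apply: (@le_lt_trans _ _ (\int[leb2]_p ((1 + (p.1 ^+ 2 + p.2 ^+ 2)) ^- 2)%:E)%E).
  apply: ge0_le_integral.
  - exact: measurableT.
  - by move=> w _; rewrite lee_fin mulr_ge0 ?phi_ge0 ?sqnp_ge0.
  - by apply/measurable_EFinP; exact: measurable_cphi.
  - apply/measurable_EFinP; apply: (measurableT_comp (@measurable_invr R)).
    apply: measurable_funX; apply: measurable_funD => //.
    by apply: measurable_funD; apply: measurable_funX.
  - move=> w _; rewrite lee_fin -/(sqnp w) /phi.
    have t0 := sqnp_ge0 w; move: (sqnp w) t0 => t t0.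
    have T0 : 0 < 1 + t by rewrite ltr_pwDl.
    rewrite mulrA ler_pdivrMr ?exprn_gt0 // -[4%N]/(2 + 2)%N exprD mulrA mulVf ?mul1r; last first.
      by rewrite expf_neq0 // gt_eqF.
    nra.
by rewrite leb2_oneDsqrV2 ltry.
Qed.

Lemma cphi_gt0 : (0 < cphi)%E.
Proof.
pose B : set RR := `[1, 2] `*` `[1, 2].
have mB : measurable B by apply: measurableX; exact: measurable_itv.
have leB : leb2 B = 1%E.
  rewrite product_measure1E; [|exact: measurable_itv|exact: measurable_itv].
  rewrite /= lebesgue_measure_itv /= lte_fin ltr1n -EFinB -EFinM.
  by congr EFin; ring.
(* On the square, t = |w|^2 lies between 2 and 8, so t^2 >= 4 and (1 + t)^4 <= 9^4. *)
pose e : R := 4 / 9 ^+ 4.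
have e0 : 0 < e by rewrite divr_gt0 // exprn_gt0.
apply: (@lt_le_trans _ _ (\int[leb2]_(w in B) e%:E)%E).
  by rewrite integral_cst // [X in (_ * X)%E]leB mule1 lte_fin.
apply: (@le_trans _ _ (\int[leb2]_(w in B) (sqnp w * phi (sqnp w))%:E)%E).
  apply: ge0_le_integral => //.
  - by move=> w _; rewrite lee_fin ltW.
  - by apply/measurable_EFinP; apply: measurable_funTS; exact: measurable_cphi.
  - move=> [x y] [/=]; rewrite !in_itv /= => /andP[x1 x2] /andP[y1 y2].
    have t2 : 2 <= sqnp (x, y) by rewrite /sqnp /=; nra.
    rewrite lee_fin /phi /e mulrA ler_pM //.
      by rewrite -expr2 (_ : 4 = 2 ^+ 2) ?lerXn2r ?nnegrE ?sqnp_ge0 //; ring.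
    rewrite lef_pV2 ?posrE ?exprn_gt0 ?ltr_pwDl ?sqnp_ge0 //.
    rewrite lerXn2r ?nnegrE ?addr_ge0 ?sqnp_ge0 // /sqnp /=; nra.
apply: ge0_subset_integral => //.
- by apply/measurable_EFinP; exact: measurable_cphi.
- by move=> w _; rewrite lee_fin mulr_ge0 ?phi_ge0 ?sqnp_ge0.
Qed.

Lemma iota_invariant_ge0 (f : CP1 R -> R) g : SU2 g ->
  measurable_fun setT (fun p : RR => f (Some (toC p))) -> (forall z, 0 <= f z) ->
  measurable_fun setT (fun p : RR => f (mobius g (Some (toC p)))) ->
  (\int[leb2]_s (f (mobius g (Some (toC s))) * (1 + sqnp s) ^- 2)%:E =
   \int[leb2]_s (f (Some (toC s)) * (1 + sqnp s) ^- 2)%:E)%E.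
Proof.
move=> hg mf f0 mfg.
have := Fphi_invariant hg mf f0.
rewrite (Fphi_total mf f0) (@Fphi_total (f \o mobius g) mfg (fun z => f0 _)).
have cfin : cphi \is a fin_num by rewrite ge0_fin_numE ?cphi_lty // ltW // cphi_gt0.
have c0 := cphi_gt0; move: cfin c0 => /fineK <-; rewrite lte_fin => c0 /=.
move=> /(congr1 (fun x => (fine cphi)^-1%:E * x)%E).
by rewrite !muleA -EFinM mulVf ?gt_eqF // !mul1e => ->.
Qed.

Lemma measurable_mobius (f : CP1 R -> R) g : SU2 g ->
  measurable_fun setT (fun p : RR => f (Some (toC p))) ->
  measurable_fun setT (fun p : RR => f (mobius g (Some (toC p)))).
Proof.
move=> /SU2P[a [b [-> h]]] mf.
have m := measurableT_comp (measurable_pt mf) (measurable_lin4 a b (- conjc b) (conjc a)).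
have m1 : measurable_fun setT (fun p : RR => (p, (1, 0) : RR)) by exact: measurable_fun_pair.
have := measurableT_comp m m1; congr measurable_fun; apply/funext => p.
have -> : Some (toC p) = pt (toC p) 1 by rewrite /pt oner_eq0 divr1.
rewrite mobius_pt ?det_su2 ?oner_eq0 //; last first.
  by rewrite xpair_eqE oner_eq0 andbF.
have [-> -> -> ->] := su2E a b.
by rewrite /comp /lin4 /fst /snd !ofCK; have -> : toC (1, 0) = 1 :> C by [].
Qed.

End Invariance.

(** * Integration of bounded measurable functions against iota *)

Section Integral.
Context {R : realType}.
Local Notation mu := (@lebesgue_measure R).
Local Notation RR := (measurableTypeR R * measurableTypeR R)%type.
Local Notation C := R[i].
Local Notation dens p := (iota_density (toC p)).

Definition Jr (h : CP1 R -> R) : R :=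
  Rintegral (@leb2 R) setT (fun p : RR => h (Some (toC p)) * dens p).

(* bounded measurable *)
Definition rbm (h : CP1 R -> R) :=
  measurable_fun setT (fun p : RR => h (Some (toC p))) /\
  exists M, forall z, `|h z| <= M.

Lemma densE (p : RR) : dens p = pi^-1 * (1 + sqnp p) ^- 2.
Proof. by rewrite /iota_density mul1r invfM. Qed.

Lemma dens_ge0 (p : RR) : 0 <= dens p.
Proof.
by rewrite densE mulr_ge0 ?invr_ge0 ?pi_ge0 // exprn_ge0 // addr_ge0 ?sqnp_ge0.
Qed.

Lemma measurable_dens : measurable_fun setT (fun p : RR => dens p).
Proof.
rewrite (_ : (fun p => _) = (fun p : RR => pi^-1 * (1 + sqnp p) ^- 2)); last first.
  by apply/funext => p; rewrite densE.
apply: measurable_funM => //; apply: (measurableT_comp (@measurable_invr R)).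
by apply: measurable_funX; apply: measurable_funD => //; exact: measurable_sqnp.
Qed.

Lemma integral_density (f : RR -> R) : measurable_fun setT f -> (forall p, 0 <= f p) ->
  (\int[@leb2 R]_p (f p * dens p)%:E =
   pi^-1%:E * \int[@leb2 R]_p (f p * (1 + sqnp p) ^- 2)%:E)%E.
Proof.
move=> mf f0; rewrite -ge0_integralZl; first last.
- by rewrite lee_fin invr_ge0 pi_ge0.
- by move=> p _; rewrite lee_fin mulr_ge0 // invr_ge0 exprn_ge0 // addr_ge0 ?sqnp_ge0.
- apply/measurable_EFinP; apply: measurable_funM => //.
  apply: (measurableT_comp (@measurable_invr R)).
  by apply: measurable_funX; apply: measurable_funD => //; exact: measurable_sqnp.
- exact: measurableT.
by apply: eq_integral => p _; rewrite densE -EFinM; congr EFin; rewrite mulrCA.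
Qed.

Lemma integral_dens : (\int[@leb2 R]_p (dens p)%:E = 1)%E.
Proof.
under eq_integral do rewrite -[dens _]mul1r.
rewrite (@integral_density (cst 1)) //.
under eq_integral do rewrite mul1r.
have := @leb2_oneDsqrV2 R; rewrite /sqnp => ->.
by rewrite -EFinM mulVf // gt_eqF // pi_gt0.
Qed.

Lemma integrable_rbm (h : CP1 R -> R) : rbm h ->
  (@leb2 R).-integrable setT (EFin \o (fun p : RR => h (Some (toC p)) * dens p)).
Proof.
move=> [mh [M hM]].
apply: (@le_integrable _ _ _ _ _ measurableT _ (fun p : RR => M%:E * (dens p)%:E)%E).
- by apply/measurable_EFinP; apply: measurable_funM => //; exact: measurable_dens.
- move=> p _; rewrite -EFinM /comp !abse_EFin lee_fin (normrM (h _)) (normrM M).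
  rewrite (ger0_norm (dens_ge0 p)) ler_wpM2r ?dens_ge0 //.
  by rewrite (le_trans (hM _)) // ler_norm.
apply: integrableZl; first exact: measurableT.
apply/integrableP; split; first by apply/measurable_EFinP; exact: measurable_dens.
rewrite (_ : (\int[_]_(x in _) _)%E = (\int[@leb2 R]_p (dens p)%:E)%E).
  by rewrite integral_dens ltry.
by apply: eq_integral => p _; rewrite gee0_abs // lee_fin dens_ge0.
Qed.

Lemma rbm_cst c : rbm (fun _ => c).
Proof. by split; [exact: measurable_cst|exists `|c|]. Qed.

Lemma rbmD f h : rbm f -> rbm h -> rbm (fun z => f z + h z).
Proof.
move=> [mf [M fM]] [mh [M' hM]]; split; first exact: measurable_funD.
by exists (M + M') => z; rewrite (le_trans (ler_normD _ _)) // lerD.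
Qed.

Lemma rbmM f h : rbm f -> rbm h -> rbm (fun z => f z * h z).
Proof.
move=> [mf [M fM]] [mh [M' hM]]; split; first exact: measurable_funM.
by exists (M * M') => z; rewrite normrM ler_pM.
Qed.

Lemma rbmN f : rbm f -> rbm (fun z => - f z).
Proof.
move=> [mf [M fM]]; split; first exact: measurable_funN.
by exists M => z; rewrite normrN.
Qed.

Lemma rbm_mobius g f : SU2 g -> rbm f -> rbm (fun z => f (mobius g z)).
Proof.
by move=> hg [mf [M fM]]; split; [exact: measurable_mobius|exists M].
Qed.

Lemma JrD f h : rbm f -> rbm h -> Jr (fun z => f z + h z) = Jr f + Jr h.
Proof.
move=> rf rh; rewrite /Jr -RintegralD; [|exact: measurableT|exact: integrable_rbm..].
by apply: eq_Rintegral => p _; rewrite mulrDl.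
Qed.

Lemma JrZ c f : rbm f -> Jr (fun z => c * f z) = c * Jr f.
Proof.
move=> rf; rewrite /Jr -RintegralZl; [|exact: measurableT|exact: integrable_rbm].
by apply: eq_Rintegral => p _; rewrite mulrA.
Qed.

Lemma JrN f : rbm f -> Jr (fun z => - f z) = - Jr f.
Proof.
move=> rf; rewrite -mulN1r -JrZ //; congr Jr.
by apply/funext => z; rewrite mulN1r.
Qed.

Lemma Jr_cst c : Jr (fun _ => c) = c.
Proof.
have J1 : Jr (fun _ => 1) = 1.
  by rewrite /Jr /Rintegral; under eq_integral do rewrite mul1r; rewrite integral_dens.
have -> : (fun _ => c) = (fun _ : CP1 R => c * 1) by apply/funext => z; rewrite mulr1.
by rewrite (JrZ c (rbm_cst 1)) J1 mulr1.
Qed.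

Lemma Jr_le f h : rbm f -> rbm h -> (forall z, f z <= h z) -> Jr f <= Jr h.
Proof.
move=> rf rh fh; apply: le_Rintegral; [exact: measurableT|exact: integrable_rbm..|].
by move=> p _; rewrite ler_wpM2r ?dens_ge0.
Qed.

Lemma Jr_invariant g f : SU2 g -> rbm f -> Jr (fun z => f (mobius g z)) = Jr f.
Proof.
move=> hg rf; have rfg := rbm_mobius hg rf.
have [M fM] := rf.2.
have rM := rbm_cst M.
(* Invariance has been shown for nonnegative functions; adding the bound M reduces to that case. *)
suff : Jr (fun z => f (mobius g z) + M) = Jr (fun z => f z + M).
  by rewrite (JrD rfg rM) (JrD rf rM) => /addIr.
have p0 z : 0 <= f z + M.
  by have := fM z; rewrite ler_norml => /andP[+ _]; rewrite -subr_ge0 opprK.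
rewrite /Jr /Rintegral; congr fine.
have m1 := (rbmD rf rM).1; have m2 := (rbmD rfg rM).1.
rewrite (integral_density m1 (fun p => p0 _)) (integral_density m2 (fun p => p0 _)).
congr (_ * _)%E.
exact: (@iota_invariant_ge0 R (fun z => f z + M) g hg m1 p0 m2).
Qed.

Definition iint (f : CP1 R -> C) : C :=
  cint (fun s => (iota_density s)%:C * f (Some s)).

Definition cbm (f : CP1 R -> C) :=
  rbm (fun z => reC (f z)) /\ rbm (fun z => imC (f z)).

Lemma reCM (z w : C) : reC (z * w) = reC z * reC w - imC z * imC w.
Proof. by case: z w => a b []. Qed.
Lemma imCM (z w : C) : imC (z * w) = reC z * imC w + imC z * reC w.
Proof. by case: z w => a b []. Qed.
Lemma reCD (z w : C) : reC (z + w) = reC z + reC w.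
Proof. by case: z w => a b []. Qed.
Lemma imCD (z w : C) : imC (z + w) = imC z + imC w.
Proof. by case: z w => a b []. Qed.
Lemma iintE f : iint f = Jr (fun z => reC (f z)) +i* Jr (fun z => imC (f z)).
Proof.
rewrite /iint /cint /Jr; congr (_ +i* _); apply: eq_Rintegral => p _.
  by rewrite reCM /= mul0r subr0 mulrC.
by rewrite imCM /= mul0r addr0 mulrC.
Qed.

Lemma cbm_cst c : cbm (fun _ => c).
Proof. by split; exact: rbm_cst. Qed.

Lemma cbmD f h : cbm f -> cbm h -> cbm (fun z => f z + h z).
Proof.
move=> [f1 f2] [h1 h2]; split.
  by under eq_fun do rewrite reCD; exact: rbmD.
by under eq_fun do rewrite imCD; exact: rbmD.
Qed.

Lemma cbmM f h : cbm f -> cbm h -> cbm (fun z => f z * h z).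
Proof.
move=> [f1 f2] [h1 h2]; split.
  under eq_fun do rewrite reCM.
  by apply: rbmD; [exact: rbmM|apply: rbmN; exact: rbmM].
by under eq_fun do rewrite imCM; apply: rbmD; exact: rbmM.
Qed.

Lemma cbm_sum (I : Type) (r : seq I) (f : I -> CP1 R -> C) :
  (forall i, cbm (f i)) -> cbm (fun z => \sum_(i <- r) f i z).
Proof.
move=> cf; elim: r => [|i r IH].
  by under eq_fun do rewrite big_nil; exact: cbm_cst.
by under eq_fun do rewrite big_cons; exact: cbmD.
Qed.

Lemma cbm_mobius g f : SU2 g -> cbm f -> cbm (fun z => f (mobius g z)).
Proof.
by move=> hg [f1 f2]; split; [exact: (rbm_mobius hg f1)|exact: (rbm_mobius hg f2)].
Qed.

Lemma iintD f h : cbm f -> cbm h -> iint (fun z => f z + h z) = iint f + iint h.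
Proof.
move=> [f1 f2] [h1 h2]; rewrite !iintE.
under eq_fun do rewrite reCD; under [in X in _ +i* X]eq_fun do rewrite imCD.
by rewrite !JrD.
Qed.

Lemma iintZ c f : cbm f -> iint (fun z => c * f z) = c * iint f.
Proof.
move=> [f1 f2]; rewrite !iintE.
under eq_fun do rewrite reCM; under [in X in _ +i* X]eq_fun do rewrite imCM.
have rz d (k : CP1 R -> R) : rbm k -> rbm (fun z => d * k z).
  by move=> rk; exact: (rbmM (rbm_cst d) rk).
rewrite JrD ?(JrN, JrZ) //; last 3 first.
- exact: rz.
- exact: rz.
- by apply: rbmN; exact: rz.
rewrite JrD ?JrZ //; [|exact: rz|exact: rz].
by case: c.
Qed.

Lemma iint_sum (I : Type) (r : seq I) (f : I -> CP1 R -> C) :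
  (forall i, cbm (f i)) ->
  iint (fun z => \sum_(i <- r) f i z) = \sum_(i <- r) iint (f i).
Proof.
move=> cf; elim: r => [|i r IH].
  rewrite big_nil; under eq_fun do rewrite big_nil.
  by rewrite iintE !Jr_cst.
rewrite big_cons; under eq_fun do rewrite big_cons.
by rewrite iintD ?IH //; exact: cbm_sum.
Qed.

Lemma iint_cst c : iint (fun _ => c) = c.
Proof. by rewrite iintE !Jr_cst; case: c. Qed.

Lemma iint_invariant g f : SU2 g -> cbm f ->
  iint (fun z => f (mobius g z)) = iint f.
Proof.
move=> hg [f1 f2]; rewrite !iintE.
by rewrite (Jr_invariant hg f1) (Jr_invariant hg f2).
Qed.

End Integral.

(** * The invariant kernel *)

Section Geometry.
Context {R : realType}.
Local Notation C := R[i].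
Local Notation CP := (CP1 R).

(** In characteristic 0 the polynomial X^n - 1 is separable, so an algebraically closed field
    contains n distinct n-th roots of unity, one of which is primitive. *)
Lemma prim_root_exists n : (0 < n)%N -> exists z : C, n.-primitive_root z.
Proof.
move=> n_gt0; pose p : {poly C} := 'X^n - 1.
have [r Dp] := closed_field_poly_normal p.
rewrite (monicP _) ?monicXnsubC // scale1r in Dp.
have rn1 : all n.-unity_root r by apply/allP => z; rewrite -root_prod_XsubC -Dp.
have sz_r : (n < (size r).+1)%N.
  by rewrite -(size_prod_XsubC r id) -Dp size_XnsubC.
have [|z] := hasP (has_prim_root n_gt0 rn1 _ sz_r); last by exists z.
by rewrite -separable_prod_XsubC -Dp separable_Xn_sub_1 // pnatr_eq0 -lt0n.
Qed.

Lemma sqnM (z w : C) : sqn (z * w) = sqn z * sqn w.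
Proof. by apply: complexI; rewrite rmorphM /= !sqnC rmorphM /=; ring. Qed.

Lemma sqn_ge0 (z : C) : 0 <= sqn z.
Proof. by rewrite addr_ge0 // sqr_ge0. Qed.

Lemma sqn_eq0 (z : C) : (sqn z == 0) = (z == 0).
Proof. by case: z => x y; rewrite /sqn /= paddr_eq0 ?sqr_ge0 // !sqrf_eq0 eq_complex. Qed.

Lemma sqn0 : sqn (0 : C) = 0. Proof. by apply/eqP; rewrite sqn_eq0. Qed.
Lemma sqn1 : sqn (1 : C) = 1. Proof. by rewrite /sqn /= expr1n expr0n addr0. Qed.
Lemma sqn_conj (z : C) : sqn (conjc z) = sqn z.
Proof. by case: z => x y; rewrite /sqn /= sqrrN. Qed.

Lemma conj_unit (z : C) : sqn z = 1 -> z * conjc z = 1.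
Proof. by move=> h; rewrite mulcJ h. Qed.

Lemma sqn_unity_root n (z : C) : (0 < n)%N -> z ^+ n = 1 -> sqn z = 1.
Proof.
move=> n0 zn; have : sqn z ^+ n = 1.
  apply: complexI; rewrite rmorphXn /= sqnC exprMn -rmorphXn /= zn.
  by rewrite rmorph1 mulr1.
by move/eqP; rewrite pexpr_eq1 // ?sqn_ge0 // => /eqP.
Qed.

Definition lift1 (z : CP) : C := if z is Some w then w else 1.
Definition lift2 (z : CP) : C := if z is Some w then 1 else 0.
Definition N2 (u v : C) : R := sqn u + sqn v.

Lemma N2_ge0 u v : 0 <= N2 u v. Proof. by rewrite addr_ge0 ?sqn_ge0. Qed.
Lemma N2_gt0 u v : (u, v) != (0, 0) -> 0 < N2 u v.
Proof.
move=> h; rewrite lt_neqAle N2_ge0 andbT eq_sym /N2 paddr_eq0 ?sqn_ge0 //.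
by rewrite !sqn_eq0; move: h; rewrite xpair_eqE.
Qed.

Lemma lift_neq0 z : (lift1 z, lift2 z) != (0, 0).
Proof. by case: z => [w|]; rewrite xpair_eqE /= oner_eq0 ?andbF. Qed.

Lemma N2_lift_gt0 z : 0 < N2 (lift1 z) (lift2 z).
Proof. exact/N2_gt0/lift_neq0. Qed.

Lemma pt_lift z : pt (lift1 z) (lift2 z) = z.
Proof. by case: z => [w|]; rewrite /pt /= ?eqxx ?oner_eq0 ?divr1. Qed.

Lemma lift_pt u v : (u, v) != (0, 0) -> exists2 c : C, c != 0 &
  u = c * lift1 (pt u v) /\ v = c * lift2 (pt u v).
Proof.
move=> uv; rewrite /pt; case: eqVneq => [v0|v0].
  exists u; last by rewrite /= mulr1 mulr0.
  by apply: contra uv => /eqP ->; rewrite v0.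
by exists v => //=; rewrite mulr1 mulrC divfK.
Qed.

Lemma lift_mobius a b z : sqn a + sqn b = 1 -> exists2 c : C, c != 0 &
  a * lift1 z + b * lift2 z = c * lift1 (mobius (su2 a b) z) /\
  - conjc b * lift1 z + conjc a * lift2 z = c * lift2 (mobius (su2 a b) z).
Proof.
move=> h; rewrite -{3 6}[z]pt_lift mobius_pt ?det_su2 ?oner_eq0 ?lift_neq0 //.
have [-> -> -> ->] := su2E a b.
apply: lift_pt; rewrite -[_ != _]negbK negbK.
have := N2_lift_gt0 z; rewrite /N2 -(su2_isometry _ _ h); apply: contraTneq => -[-> ->].
by rewrite sqn0 addr0 ltxx.
Qed.

Lemma N2_scale (c u v : C) : N2 (c * u) (c * v) = sqn c * N2 u v.
Proof. by rewrite /N2 !sqnM; ring. Qed.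

(** The base of the Berezin kernel, extended to infinity: the expression is homogeneous of degree 0
    in each pair of coordinates, so representatives do not matter. *)
Definition ker (z s : CP) : R :=
  sqn (lift1 z * conjc (lift1 s) + lift2 z * conjc (lift2 s)) /
  (N2 (lift1 z) (lift2 z) * N2 (lift1 s) (lift2 s)).

(** SU(2) preserves the Hermitian form of C^2. The lifts of the image points differ from the images
    of the lifts by scalars c and d, whose squared moduli cancel in the quotient. *)
Lemma ker_mobius g z s : SU2 g -> ker (mobius g z) (mobius g s) = ker z s.
Proof.
move=> /SU2P[a [b [-> h]]].
have [c c0 [c1 c2]] := lift_mobius z h; have [d d0 [d1 d2]] := lift_mobius s h.
have Nz : N2 (lift1 z) (lift2 z) = sqn c * N2 (lift1 (mobius (su2 a b) z)) (lift2 (mobius (su2 a b) z)).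
  by rewrite -N2_scale -c1 -c2 /N2 su2_isometry.
have Ns : N2 (lift1 s) (lift2 s) = sqn d * N2 (lift1 (mobius (su2 a b) s)) (lift2 (mobius (su2 a b) s)).
  by rewrite -N2_scale -d1 -d2 /N2 su2_isometry.
have e : lift1 z * conjc (lift1 s) + lift2 z * conjc (lift2 s) = c * conjc d *
   (lift1 (mobius (su2 a b) z) * conjc (lift1 (mobius (su2 a b) s)) +
    lift2 (mobius (su2 a b) z) * conjc (lift2 (mobius (su2 a b) s))).
  rewrite mulrDr mulrACA -rmorphM -c1 -d1 mulrACA -rmorphM -c2 -d2.
  rewrite !rmorphD !rmorphM /= rmorphN /= !conjcK.
  have e1 := congr1 (real_complex R) h; rewrite rmorphD /= !sqnC rmorph1 in e1.
  rewrite -[LHS]mul1r -e1; ring.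
rewrite /ker Nz Ns e !sqnM sqn_conj.
have cc : sqn c != 0 by rewrite sqn_eq0.
have dd : sqn d != 0 by rewrite sqn_eq0.
have n1 := lt0r_neq0 (N2_lift_gt0 (mobius (su2 a b) z)).
have n2 := lt0r_neq0 (N2_lift_gt0 (mobius (su2 a b) s)).
field; rewrite cc dd n1 n2 //.
Qed.

Lemma kerC z s : ker z s = ker s z.
Proof.
rewrite /ker [in RHS](mulrC (N2 _ _)); congr (_ / _).
by rewrite -sqn_conj rmorphD !rmorphM /= !conjcK ![_^*%C * _]mulrC.
Qed.

(** This is the variable y = 1 / (1 + |z|^2), with value 0 at infinity. *)
Definition ker0 (z : CP) : R := ker (Some 0) z.

Lemma ker0E z : ker0 z = sqn (lift2 z) / N2 (lift1 z) (lift2 z).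
Proof.
rewrite /ker0 /ker /= mul0r add0r mul1r sqn_conj.
by rewrite {1}/N2 sqn0 sqn1 add0r mul1r.
Qed.

Lemma ker0_0 : ker0 (Some 0) = 1.
Proof. by rewrite ker0E /= /N2 sqn0 sqn1 add0r divr1. Qed.

(* matrix coefficients of the kernel, in homogeneous coordinates *)
Definition kermon j a b (z : CP) : C :=
  lift1 z ^+ a * lift2 z ^+ (j - a) * conjc (lift1 z ^+ b * lift2 z ^+ (j - b)) /
  (N2 (lift1 z) (lift2 z) ^+ j)%:C.

(** Two binomial expansions separate z from s. That the kernel has finite rank is what later turns
    exchanges of integrals into exchanges of finite sums. *)
Lemma ker_expand j z s : (ker z s ^+ j)%:C =
  \sum_(a < j.+1) \sum_(b < j.+1)
    ('C(j, a))%:R * ('C(j, b))%:R * kermon j a b z * kermon j b a s.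
Proof.
have E (u v : C) : (u + v) ^+ j =
    \sum_(a < j.+1) ('C(j, a))%:R * (u ^+ a * v ^+ (j - a)).
  rewrite addrC exprDn; apply: eq_bigr => a _.
  by rewrite -mulr_natl [v ^+ _ * _]mulrC.
rewrite /ker expr_div_n rmorphM rmorphXn /= sqnC fmorphV /= exprMn.
rewrite rmorphD !rmorphM /= !conjcK !E big_distrlr /= mulr_suml.
apply: eq_bigr => a _; rewrite mulr_suml; apply: eq_bigr => b _.
have -> : ((N2 (lift1 z) (lift2 z) * N2 (lift1 s) (lift2 s)) ^+ j)%:C =
    (N2 (lift1 z) (lift2 z) ^+ j)%:C * (N2 (lift1 s) (lift2 s) ^+ j)%:C :> C.
  by rewrite exprMn rmorphM.
rewrite /kermon invfM !exprMn !rmorphM /= !rmorphXn /=.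
move: (lift1 z ^+ a) (lift2 z ^+ (j - a)) (lift1 s ^+ b) (lift2 s ^+ (j - b)).
move: (conjc (lift1 z) ^+ b) (conjc (lift2 z) ^+ (j - b)) (conjc (lift1 s) ^+ a)
  (conjc (lift2 s) ^+ (j - a)).
move: (_ ^+ j)^-1 (_ ^+ j)^-1 ('C(j, a)%:R) ('C(j, b)%:R) => *; ring.
Qed.

Lemma kermon_diag j a z : (a <= j)%N -> kermon j a a z = ((1 - ker0 z) ^+ a * ker0 z ^+ (j - a))%:C.
Proof.
move=> aj; have n0 := lt0r_neq0 (N2_lift_gt0 z).
have e : 1 - ker0 z = sqn (lift1 z) / N2 (lift1 z) (lift2 z).
  by rewrite ker0E -[X in X - _](divff n0) -mulrBl {1}/N2 addrK.
rewrite e ker0E !expr_div_n mulrACA -invfM -exprD subnKC // /kermon.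
rewrite [RHS]rmorphM /= fmorphV /= mulcJ sqnM.
have sX (w : C) n : sqn (w ^+ n) = sqn w ^+ n.
  by elim: n => [|n IH]; rewrite ?sqn1 // !exprS sqnM IH.
by rewrite !sX.
Qed.

(** The matrix acts as the rotation z -> h^2 z, and for |h| = 1 the factor is h^(2(a - b)), written
    here with natural exponents only. *)
Lemma kermon_rot j a b (h : C) z : sqn h = 1 -> (a <= j)%N -> (b <= j)%N ->
  kermon j a b (mobius (su2 h 0) z) =
  h ^+ (a + (j - b)) * conjc h ^+ (j - a + b) * kermon j a b z.
Proof.
move=> h1 aj bj; have hh : sqn h + sqn 0 = 1 by rewrite sqn0 addr0.
have [c c0 [c1 c2]] := lift_mobius z hh.
rewrite rmorph0 oppr0 !mul0r addr0 add0r in c1 c2.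
set z' := mobius _ _ in c1 c2 *.
have cc : c * conjc c != 0 by rewrite mulf_neq0 // conjc_eq0.
have Nz : N2 (lift1 z) (lift2 z) = sqn c * N2 (lift1 z') (lift2 z').
  by rewrite -N2_scale -c1 -c2 /N2 !sqnM sqn_conj h1 !mul1r.
have n1 : (N2 (lift1 z') (lift2 z'))%:C != 0 :> C.
  by rewrite fmorph_eq0 lt0r_neq0 // N2_lift_gt0.
have Nz1 : (N2 (lift1 z) (lift2 z) ^+ j)%:C =
    (c * conjc c) ^+ j * (N2 (lift1 z') (lift2 z'))%:C ^+ j.
  by rewrite Nz exprMn rmorphM !rmorphXn /= sqnC.
have Nz2 : (N2 (lift1 z') (lift2 z') ^+ j)%:C = (N2 (lift1 z') (lift2 z'))%:C ^+ j :> C.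
  by rewrite rmorphXn.
rewrite /kermon Nz1 Nz2.
apply: (mulIf (expf_neq0 j n1)); rewrite divfK ?expf_neq0 //.
apply: (mulIf (expf_neq0 j cc)).
have -> : h ^+ (a + (j - b)) * conjc h ^+ (j - a + b) *
   (lift1 z ^+ a * lift2 z ^+ (j - a) * conjc (lift1 z ^+ b * lift2 z ^+ (j - b)) /
    ((c * conjc c) ^+ j * (N2 (lift1 z') (lift2 z'))%:C ^+ j)) *
   (N2 (lift1 z') (lift2 z'))%:C ^+ j * (c * conjc c) ^+ j =
   ((h * lift1 z) ^+ a * (conjc h * lift2 z) ^+ (j - a)) *
   conjc ((h * lift1 z) ^+ b * (conjc h * lift2 z) ^+ (j - b)).
  rewrite !rmorphM /= !rmorphXn /= !rmorphM /= conjcK !exprMn !exprD.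
  have := expf_neq0 j n1; have := expf_neq0 j cc; rewrite !exprMn.
  move: ((N2 (lift1 z') (lift2 z'))%:C ^+ j) => X; move: (c ^+ j) (conjc c ^+ j) => Y Z.
  by rewrite mulf_eq0 negb_or => /andP[Y0 Z0] X0; field; rewrite X0 Y0 Z0.
have -> : (c * conjc c) ^+ j =
    c ^+ a * c ^+ (j - a) * (conjc c ^+ b * conjc c ^+ (j - b)).
  by rewrite -!exprD !subnKC // exprMn.
rewrite c1 c2 !rmorphM /= !rmorphXn /= !rmorphM /= !exprMn; ring.
Qed.

Lemma mobius_comp g h z : @SU2 R g -> SU2 h ->
  mobius (g *m h) z = mobius g (mobius h z).
Proof.
move=> [_ dg] hh; have [_ dh] := hh.
have [a [b [hE ab]]] := SU2P hh.
rewrite -[z]pt_lift [mobius h _]mobius_pt ?dh ?oner_eq0 ?lift_neq0 //.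
rewrite !mobius_pt ?det_mulmx ?dg ?dh ?mulr1 ?oner_eq0 ?lift_neq0 //; last first.
  rewrite hE; have [-> -> -> ->] := su2E a b.
  have := N2_lift_gt0 z; rewrite /N2 -(su2_isometry _ _ ab); apply: contraTneq => -[-> ->].
  by rewrite sqn0 addr0 ltxx.
rewrite !mxE !big_ord_recl !big_ord0 (_ : lift ord0 ord0 = ord_max :> 'I_2); last exact/val_inj.
by congr pt; ring.
Qed.

Lemma SU2_unit g : @SU2 R g -> g \in unitmx.
Proof. by move=> [_ dg]; rewrite unitmxE dg unitr1. Qed.

Lemma invmx_su2 (a b : C) : sqn a + sqn b = 1 -> invmx (su2 a b) = su2 (conjc a) (- b).
Proof.
move=> h; have u := SU2_unit (SU2_su2 h).
have h' : a * conjc a + b * conjc b = 1 by rewrite !mulcJ -rmorphD h.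
apply: (can_inj (mulKmx u)); rewrite mulmxV //.
apply/matrixP => i j; rewrite !mxE !big_ord_recl !big_ord0.
rewrite (_ : lift ord0 ord0 = ord_max :> 'I_2); last exact/val_inj.
by have [->|->] := ord2E i; have [->|->] := ord2E j; rewrite !mxE /= ?rmorphN /= ?conjcK -?h'; ring.
Qed.

Lemma SU2V g : @SU2 R g -> SU2 (invmx g).
Proof.
move=> /SU2P[a [b [-> h]]]; rewrite invmx_su2 //; apply: SU2_su2.
by rewrite sqn_conj -mulN1r sqnM (_ : sqn (-1 : C) = 1) ?mul1r // /sqn /= oppr0 expr0n addr0 sqrrN expr1n.
Qed.

Lemma mobius1 z : mobius (1%:M : 'M[C]_2) z = z.
Proof.
rewrite -{1}[z]pt_lift mobius_pt ?det1 ?oner_eq0 ?lift_neq0 // !mxE /=.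
by rewrite !mul1r !mul0r addr0 add0r pt_lift.
Qed.

Lemma mobiusKV g z : @SU2 R g -> mobius (invmx g) (mobius g z) = z.
Proof. by move=> hg; rewrite -mobius_comp ?mulVmx ?mobius1 ?SU2_unit //; exact: SU2V. Qed.

(** Used in two ways: transitivity reduces claims at z to claims at 0, and the exchange of the two
    points gives the symmetry between two kernels. *)
Lemma mobius_swap z : exists g : 'M[C]_2, [/\ SU2 g, mobius g (Some 0) = z &
  mobius g z = Some 0].
Proof.
case: z => [w|]; last first.
  have h : sqn (0 : C) + sqn (1 : C) = 1 by rewrite sqn0 sqn1 add0r.
  exists (su2 0 1); split; first exact: SU2_su2.
    rewrite /mobius; have [-> -> -> ->] := su2E (0 : C) 1.
    by rewrite mulr0 rmorph0 addr0 eqxx.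
  rewrite /mobius; have [-> _ -> _] := su2E (0 : C) 1.
  by rewrite rmorph1 oppr_eq0 oner_eq0 mul0r.
have A0 : 0 < 1 + sqn w by rewrite ltr_pwDl // sqn_ge0.
pose r := Num.sqrt (1 + sqn w)^-1.
have rr : r ^+ 2 = (1 + sqn w)^-1 by rewrite sqr_sqrtr // invr_ge0 ltW.
have r0 : r != 0 by rewrite -sqrf_eq0 rr invr_eq0 gt_eqF.
(* A purely imaginary a gives the matrix trace 0, so its square is -1 and its Möbius map is an
   involution: sending 0 to w, it sends w back to 0. *)
pose a : C := 0 +i* r.
have sa : sqn a = (1 + sqn w)^-1 by rewrite /sqn /= expr0n add0r rr.
have h : sqn a + sqn (- (w * a)) = 1.
  rewrite -mulN1r !sqnM sa (_ : sqn (-1 : C) = 1); last first.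
    by rewrite /sqn /= oppr0 expr0n addr0 sqrrN expr1n.
  by rewrite mul1r -{1}[_^-1]mul1r -mulrDl mulfV // gt_eqF.
have a0 : a != 0 by rewrite -sqn_eq0 sa invr_eq0 gt_eqF.
have ca : conjc a = - a by rewrite /a /=; apply/eqP; rewrite eq_complex /= oppr0 !eqxx.
clearbody a; exists (su2 a (- (w * a))); split; first exact: SU2_su2.
  rewrite /mobius; have [-> -> -> ->] := su2E a (- (w * a)).
  rewrite !mulr0 !add0r ca oppr_eq0 (negbTE a0); congr Some.
  by rewrite invrN mulrNN mulfK.
rewrite /mobius; have [-> -> -> ->] := su2E a (- (w * a)).
rewrite rmorphN opprK rmorphM /= ca.
have -> : conjc w * - a * w + - a = - a * (1 + sqn w)%:C.
  by rewrite (rmorphD (real_complex R)) rmorph1 /= sqnC; ring.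
rewrite mulf_eq0 oppr_eq0 (negbTE a0) fmorph_eq0 gt_eqF //=; congr Some.
by rewrite [w * a]mulrC subrr mul0r.
Qed.

Lemma berezin_ker tau z s : berezin_kernel tau z s = ker (Some z) (Some s) ^+ tau.
Proof.
rewrite /berezin_kernel /ker /lift1 /lift2 /N2 rmorph1 mulr1 sqn1 expr_div_n exprMn.
by rewrite ![sqn _ + 1]addrC [_ * _ + 1]addrC.
Qed.

End Geometry.

(** * Shifted Legendre polynomials *)

Section Formal.
Context {F : numFieldType}.
Implicit Types p q : {poly F}.

(* formal integral over [0, 1] *)
Definition pint p : F := \sum_(i < size p) p`_i / i.+1%:R.

Lemma pintE p n : (size p <= n)%N -> pint p = \sum_(i < n) p`_i / i.+1%:R.
Proof.
move=> sp; rewrite /pint (big_ord_widen _ (fun i => p`_i / i.+1%:R) sp).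
rewrite big_mkcond; apply: eq_bigr => i _; case: ltnP => // h.
by rewrite nth_default // mul0r.
Qed.

Lemma pintD p q : pint (p + q) = pint p + pint q.
Proof.
have h1 := leq_maxl (size p) (size q); have h2 := leq_maxr (size p) (size q).
rewrite (pintE h1) (pintE h2) (pintE (size_polyD p q)) -big_split.
by apply: eq_bigr => i _; rewrite coefD mulrDl.
Qed.

Lemma pintZ c p : pint (c *: p) = c * pint p.
Proof.
rewrite (pintE (leqnn (size p))) (pintE (size_scale_leq c p)) mulr_sumr.
by apply: eq_bigr => i _; rewrite coefZ mulrA.
Qed.

Lemma pint0 : pint 0 = 0.
Proof. by rewrite /pint size_poly0 big_ord0. Qed.

Lemma pintN p : pint (- p) = - pint p.
Proof. by rewrite -scaleN1r pintZ mulN1r. Qed.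

Lemma pintB p q : pint (p - q) = pint p - pint q.
Proof. by rewrite pintD pintN. Qed.

Lemma pint_sum (I : Type) (r : seq I) (P : pred I) (G : I -> {poly F}) :
  pint (\sum_(i <- r | P i) G i) = \sum_(i <- r | P i) pint (G i).
Proof. exact: (big_morph pint pintD pint0). Qed.

Lemma pintXn n : pint 'X^n = n.+1%:R^-1.
Proof.
rewrite /pint size_polyXn big_ord_recr /= coefXn eqxx mul1r big1 ?add0r // => i _.
by rewrite coefXn ltn_eqF // mul0r.
Qed.

Lemma pint_deriv p : pint p^`() = p.[1] - p.[0].
Proof.
rewrite (pintE (n := (size p).-1)); last first.
  by have [->|p0] := eqVneq p 0; [rewrite deriv0 size_poly0|
     rewrite -ltnS prednK ?size_poly_gt0 //; exact: lt_size_deriv].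
rewrite [p.[0]]horner_coef0 horner_coef.
case E : (size p) => [|n].
  by rewrite !big_ord0 nth_default ?E // subr0.
rewrite big_ord_recl /= expr0 mulr1 addrAC subrr add0r.
apply: eq_bigr => i _; rewrite coef_deriv expr1n mulr1 /bump /= add1n.
by rewrite -[_ *+ _]mulr_natr mulfK // pnatr_eq0.
Qed.

Lemma pint_parts p q : p.[1] * q.[1] = 0 -> p.[0] * q.[0] = 0 ->
  pint (p^`() * q) = - pint (p * q^`()).
Proof.
move=> h1 h0; apply/eqP; rewrite -addr_eq0 -pintD -derivM pint_deriv.
by rewrite !hornerM h1 h0 subrr.
Qed.

(** The Beta integral: each integration by parts trades a factor X - 1 for a factor X. The sign
    appears because X - 1 replaces 1 - X. *)
Lemma pint_beta a b : pint ('X^a * ('X - 1%:P) ^+ b) =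
  (-1) ^+ b * (a`!)%:R * (b`!)%:R / ((a + b).+1`!)%:R.
Proof.
elim: b a => [|b IH] a.
  rewrite expr0 mulr1 pintXn addn0 mul1r mulr1 factS natrM invfM.
  by rewrite mulrCA mulfV ?mulr1 // pnatr_eq0 -lt0n fact_gt0.
have a0 : a.+1%:R != 0 :> F by rewrite pnatr_eq0.
have -> : 'X^a * ('X - 1%:P) ^+ b.+1 =
  a.+1%:R^-1 *: (deriv 'X^(a.+1) * ('X - 1%:P) ^+ b.+1) :> {poly F}.
  by rewrite derivXn -[X in _ *: (X * _)]scaler_nat -scalerAl scalerA mulVf // scale1r.
rewrite pintZ pint_parts; last 2 first.
- by rewrite !hornerE subrr expr0n mulr0.
- by rewrite !hornerE expr0n mul0r.
rewrite deriv_exp derivXsubC mul1r [X in pint X]mulrnAr -[X in pint X]scaler_nat pintZ IH.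
have f0 n : (n`!)%:R != 0 :> F by rewrite pnatr_eq0 -lt0n fact_gt0.
rewrite addSnnS; move: (f0 (a + b.+1).+1); move: (((a + b.+1).+1)`!%:R) => D D0.
rewrite (factS a) (factS b) !natrM exprS; field.
by rewrite D0 nat1r a0.
Qed.

(** A zero of order n keeps order n - l after l derivatives. For l < n this kills boundary terms;
    for l = n the leading factor gives the value at the zero. *)
Lemma derivn_root_factor (c : F) n l (r : {poly F}) : (l <= n)%N ->
  exists s, derivn l (('X - c%:P) ^+ n * r) =
    ('X - c%:P) ^+ (n - l) * ((n ^_ l)%:R *: r + ('X - c%:P) * s).
Proof.
elim: l => [|l IH] ln.
  by exists 0; rewrite derivn0 subn0 ffactn0 scale1r mulr0 addr0.
rewrite derivnS; have [s ->] := IH (ltnW ln).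
set k := (n - l.+1)%N.
set Y := 'X - c%:P.
exists (k.+1%:R *: s + (n ^_ l)%:R *: deriv r + s + Y * deriv s).
rewrite ffactnSr -(subnSK ln) -/k.
rewrite derivM deriv_exp derivXsubC mul1r derivD derivM derivXsubC derivZ.
rewrite /= mul1r -!mul_polyC -[_ *+ k.+1]mulr_natr !natrM !polyCM !rmorph_nat exprS.
ring.
Qed.

(** Rodrigues' formula on [0, 1]; [nderivn] includes the factor 1 / j!, which normalizes the value
    at 1 to 1. *)
Definition legendre j : {poly F} := nderivn j ('X^j * ('X - 1%:P) ^+ j).

Lemma legendreE j : (j`!)%:R *: legendre j = derivn j ('X^j * ('X - 1%:P) ^+ j).
Proof. by rewrite nderivn_def scaler_nat. Qed.

Lemma fact_neq0 n : (n`!)%:R != 0 :> F.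
Proof. by rewrite pnatr_eq0 -lt0n fact_gt0. Qed.

Lemma legendre_size j : (size (legendre j) <= j.+1)%N.
Proof.
apply/leq_sizeP => i ij; rewrite coef_nderivn nth_default ?mul0rn //.
apply: leq_trans (size_polyMleq _ _) _.
by rewrite size_polyXn size_exp_XsubC addnS /= addSnnS leq_add2l.
Qed.

Lemma legendre_lead j : (legendre j)`_j = ('C(j.*2, j))%:R.
Proof.
rewrite coef_nderivn addnn.
have m : 'X^j * ('X - 1%:P) ^+ j \is @monic F.
  by rewrite rpredM // ?monicXn ?monic_exp ?monicXsubC.
have /monicP := m; rewrite lead_coefE.
rewrite size_Mmonic ?monic_exp ?monicXsubC // ?expf_neq0 ?polyX_eq0 //.
by rewrite size_polyXn size_exp_XsubC addnS /= addnn => ->.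
Qed.

Lemma legendre1 j : (legendre j).[1] = 1.
Proof.
have [s] := @derivn_root_factor 1 j j 'X^j (leqnn j).
rewrite mulrC -legendreE subnn expr0 mul1r ffactnn => /(congr1 (horner^~ 1)).
rewrite !hornerE subrr mul0r addr0 expr1n mulr1 => h.
by apply: (mulfI (fact_neq0 j)); rewrite h mulr1.
Qed.

(** The boundary terms vanish because fewer than j derivatives leave a zero at both 0 and 1. *)
Lemma pint_legendre_parts j l (q : {poly F}) : (l <= j)%N ->
  pint (derivn j ('X^j * ('X - 1%:P) ^+ j) * q) =
  (-1) ^+ l * pint (derivn (j - l) ('X^j * ('X - 1%:P) ^+ j) * derivn l q).
Proof.
elim: l => [|l IH] lj; first by rewrite subn0 mul1r.
rewrite IH ?(ltnW lj) // -(subnSK lj) !derivnS exprS -mulrA mulN1r.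
rewrite pint_parts ?mulrN -?derivnS //.
  have [s] := @derivn_root_factor 1 j (j - l.+1) 'X^j (leq_subr _ _).
  rewrite mulrC => ->; rewrite !hornerE subrr expr0n subKn //.
  by rewrite /= !mul0r.
have [s] := @derivn_root_factor 0 j (j - l.+1) (('X - 1%:P) ^+ j) (leq_subr _ _).
rewrite subr0 => ->; rewrite !hornerE expr0n subKn //.
by rewrite /= !mul0r.
Qed.

(** All j derivatives are moved onto X^t, leaving a Beta integral; the two signs (-1)^j cancel. For
    t < j the falling factorial is 0, which is the orthogonality to lower powers. *)
Lemma pint_Xn_legendre t j :
  pint ('X^t * legendre j) = (t ^_ j * t`!)%:R / ((t + j).+1`!)%:R.
Proof.
apply: (mulfI (fact_neq0 j)); rewrite -pintZ scalerAr legendreE mulrC.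
rewrite (pint_legendre_parts _ (leqnn j)) subnn derivn0 derivnXn.
have [tj|jt] := ltnP t j.
  by rewrite ffact_small // mulr0n mulr0 pint0 mulr0 mul0n mul0r mulr0.
rewrite mulrnAr mulrAC -exprD subnKC // -[X in pint X]scaler_nat pintZ pint_beta.
rewrite natrM !mulrA [_ * (-1) ^+ j]mulrC !mulrA -exprD addnn -signr_odd odd_double mul1r.
ring.
Qed.

(** Only the leading monomial of one factor survives orthogonality, so the norm is the leading
    coefficient times a moment. *)
Lemma pint_legendre_sqr j : pint (legendre j * legendre j) = j.*2.+1%:R^-1.
Proof.
rewrite {1}(_ : legendre j = \sum_(i < j.+1) (legendre j)`_i *: 'X^i); last first.
  by rewrite -poly_def; apply/polyP => i; rewrite coef_poly; case: ltnP => // h;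
     rewrite nth_default // (leq_trans (legendre_size j)).
rewrite mulr_suml pint_sum big_ord_recr /= big1 ?add0r => [|i _]; last first.
  by rewrite -scalerAl pintZ pint_Xn_legendre ffact_small // mul0n mul0r mulr0.
rewrite -scalerAl pintZ pint_Xn_legendre legendre_lead ffactnn addnn.
rewrite mulrA -natrM.
rewrite (_ : ('C(j.*2, j) * (j`! * j`!))%N = (j.*2)`!); last first.
  by rewrite -{1}(@bin_fact j.*2 j) -?addnn ?leq_addr // addnK.
by rewrite factS natrM invfM mulrCA mulfV ?mulr1 // fact_neq0.
Qed.

(** Pairing d with the Legendre polynomial of its own degree isolates its leading coefficient. The
    argument uses no positivity, so it is valid for complex coefficients. *)
Lemma pint_orth_eq0 n (d : {poly F}) : (size d <= n)%N ->
  (forall i, (i < n)%N -> pint (d * 'X^i) = 0) -> d = 0.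
Proof.
move=> dn h; apply/eqP; apply: contraT => d0.
pose e := (size d).-1.
have se : size d = e.+1 by rewrite /e prednK // size_poly_gt0.
have h1 (q : {poly F}) : (size q <= n)%N -> pint (d * q) = 0.
  move=> qn; rewrite (_ : q = \sum_(i < size q) q`_i *: 'X^i); last first.
    by rewrite -poly_def coefK.
  rewrite mulr_sumr pint_sum big1 // => i _.
  by rewrite -scalerAr pintZ h ?mulr0 // (leq_trans _ qn).
have := h1 (legendre e); rewrite (leq_trans (legendre_size e)) -?se // => /(_ isT).
rewrite {1}(_ : d = \sum_(i < e.+1) d`_i *: 'X^i); last first.
  by rewrite -poly_def -se coefK.
rewrite mulr_suml pint_sum big_ord_recr /= big1 ?add0r => [|i _]; last first.
  by rewrite -scalerAl pintZ pint_Xn_legendre ffact_small // mul0n mul0r mulr0.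
rewrite -scalerAl pintZ pint_Xn_legendre ffactnn natrM => /eqP.
rewrite !mulf_eq0 invr_eq0 !(negbTE (fact_neq0 _)) !orbF.
by rewrite -[d`_e]/(d`_(size d).-1) -lead_coefE lead_coef_eq0 (negbTE d0).
Qed.

Lemma legendre_unique j (q : {poly F}) : (size q <= j.+1)%N ->
  (forall i, (i < j)%N -> pint (q * 'X^i) = 0) -> q = q.[1] *: legendre j.
Proof.
move=> sq h.
have c0 : ('C(j.*2, j))%:R != 0 :> F.
  by rewrite pnatr_eq0 -lt0n bin_gt0 -addnn leq_addr.
(* This multiple matches the coefficient of X^j, so the difference has degree below j and is
   orthogonal to all powers below j. The scalar is then read off at 1. *)
pose a := q`_j / ('C(j.*2, j))%:R.
have e : q - a *: legendre j = 0.
  apply: (@pint_orth_eq0 j).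
    apply/leq_sizeP => i; rewrite leq_eqVlt => /orP[/eqP <-|ij].
      by rewrite coefB coefZ legendre_lead /a divfK // subrr.
    rewrite coefB coefZ nth_default ?(leq_trans sq) //.
    by rewrite nth_default ?mulr0 ?subr0 // (leq_trans (legendre_size j)).
  move=> i ij; rewrite mulrBl pintB h // -scalerAl pintZ [_ * 'X^i]mulrC pint_Xn_legendre.
  by rewrite ffact_small // mul0n mul0r mulr0 subrr.
move/eqP: e; rewrite subr_eq0 => /eqP e.
by rewrite {1}e e hornerZ legendre1 mulr1.
Qed.

End Formal.

(** * Continuous functions on the sphere are bounded and measurable *)

Section Topo.
Context {R : realType}.
Local Notation RR := (measurableTypeR R * measurableTypeR R)%type.
Local Notation C := R[i].
Local Notation Ct := (@Ctop R).

Lemma normc_sqn (z : C) : `|z| = (Num.sqrt (sqn z))%:C.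
Proof. by rewrite normc_def; case: z. Qed.

Lemma normc_lt (z : C) (e : R) : 0 < e -> sqn z < e ^+ 2 -> `|z| < e%:C.
Proof.
move=> e0 h; rewrite normc_sqn ltcR -(gtr0_norm e0) -sqrtr_sqr ltr_sqrt //.
by rewrite exprn_gt0.
Qed.

Lemma normc_sqn_lt (z : C) (e : R) : 0 < e -> `|z| < e%:C -> sqn z < e ^+ 2.
Proof.
move=> e0; rewrite normc_sqn ltcR -{1}(gtr0_norm e0) -sqrtr_sqr ltr_sqrt //.
by rewrite exprn_gt0.
Qed.

Lemma gt0_complex (e : C) : 0 < e -> exists2 r : R, 0 < r & e = r%:C.
Proof.
case: e => a b; rewrite ltcE /= => /andP[/eqP -> a0]; by exists a.
Qed.

Lemma continuous_eps (f : Ct -> Ct) (x : Ct) : {for x, continuous f} ->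
  forall e : R, 0 < e -> exists2 d : R, 0 < d &
    forall y : C, sqn (y - x) < d ^+ 2 -> sqn (f y - f x) < e ^+ 2.
Proof.
move=> cf e e0.
have e0' : 0 < (e%:C : Ct) by rewrite ltcR.
have /cvgrPdist_lt /(_ _ e0') := cf.
move=> /nbhs_ballP[d /= d0 h].
have [r r0 dE] := gt0_complex d0.
exists r => // y yx.
have : `|f x - f y| < (e%:C : Ct).
  apply: h; rewrite -ball_normE /= dE distrC.
  exact: normc_lt.
rewrite distrC => h2; exact: normc_sqn_lt.
Qed.

Lemma continuous_toC (f : Ct -> Ct) : continuous f ->
  continuous (fun p : R * R => reC (f (toC p))) /\
  continuous (fun p : R * R => imC (f (toC p))).
Proof.
move=> cf.
have key (h : C -> R) : (forall z w : C, `|h z - h w| ^+ 2 <= sqn (z - w)) ->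
    continuous (fun p : R * R => h (f (toC p))).
  move=> hh p; apply/cvgrPdist_lt => e e0.
  have [d d0 hd] := continuous_eps (cf (toC p)) e0.
  have d20 : 0 < d / 2 by rewrite divr_gt0.
  exists (ball p.1 (d / 2), ball p.2 (d / 2)).
    by split; exact: nbhsx_ballx.
  move=> q [] /=; rewrite -!ball_normE /= => q1 q2.
  rewrite -(ltr_pXn2r (n := 2)) ?nnegrE ?(ltW e0) //.
  apply: le_lt_trans (hh _ _) _; rewrite -[sqn _]/(sqn (f (toC p) - f (toC q))).
  have -> : sqn (f (toC p) - f (toC q)) = sqn (f (toC q) - f (toC p)).
    by case: (f (toC p)) (f (toC q)) => a b [a' b']; rewrite /sqn /=; ring.
  apply: hd.
  have -> : sqn (toC q - toC p) = `|p.1 - q.1| ^+ 2 + `|p.2 - q.2| ^+ 2.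
    by rewrite /sqn /= !real_normK ?num_real //; ring.
  have := normr_ge0 (p.1 - q.1); have := normr_ge0 (p.2 - q.2).
  move: (`|p.1 - q.1|) (`|p.2 - q.2|) q1 q2 => x y; nra.
split; apply: key => -[a b] [c d]; rewrite /sqn /= real_normK ?num_real //.
  by rewrite lerDl sqr_ge0.
by rewrite lerDr sqr_ge0.
Qed.

(** Measurability refers to the product sigma-algebra, so an open set is written as a countable
    union of boxes with rational centres. *)
Lemma measurable_open_plane (U : set (R * R)) : open U ->
  @measurable _ (measurableTypeR R * measurableTypeR R)%type U.
Proof.
move=> oU.
pose box (a b : rat) (n : nat) : set RR :=
  `](ratr a - n.+1%:R^-1), (ratr a + n.+1%:R^-1)[ `*`
  `](ratr b - n.+1%:R^-1), (ratr b + n.+1%:R^-1)[.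
pose D a b n := [set x | box a b n `<=` U /\ box a b n x].
have -> : U = \bigcup_(a : rat) \bigcup_(b : rat) \bigcup_(n : nat) D a b n.
  apply/seteqP; split; last first.
    by move=> p [a _ [b _ [n _ [h1 h2]]]]; exact: h1.
  move=> p Up; have := oU p Up => /nbhs_ballP[e /= e0 he].
  (* With half-width 1 / (n + 1) < e / 2, a box containing p stays within distance e of p. A box not
     contained in U contributes the empty set [D a b n]. *)
  pose n := Num.truncn (2 / e).
  have n0 : 0 < n.+1%:R^-1 :> R by rewrite invr_gt0.
  have ne : n.+1%:R^-1 < e / 2.
    rewrite -[e / 2]invrK ltf_pV2 ?posrE ?invr_gt0 ?divr_gt0 // invf_div.
    by rewrite truncnS_gt // divr_ge0 // ltW.
  have pick (x dl : R) : 0 < dl -> exists a : rat, `|x - ratr a| < dl.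
    move=> dl0; have : x - dl < x + dl by lra.
    move=> /rat_in_itvoo[a]; rewrite in_itv /= => /andP[h1 h2].
    by exists a; rewrite ltr_norml; apply/andP; split; lra.
  have [a ha] := pick p.1 _ n0; have [b hb] := pick p.2 _ n0.
  have inbox (x c dl : R) : `|x - c| < dl -> x \in `](c - dl), (c + dl)[%R.
    by rewrite in_itv /= ltr_norml => /andP[h1 h2]; apply/andP; split; lra.
  exists a => //; exists b => //; exists n => //; split; last first.
    by split; exact: inbox.
  have close (x y c dl : R) : dl < e / 2 -> `|x - c| < dl -> c - dl < y < c + dl ->
      `|x - y| < e.
    rewrite !ltr_norml => h0 /andP[h1 h2] /andP[h3 h4].
    by apply/andP; split; lra.
  move=> q [] /=; rewrite !in_itv /= => q1 q2.
  apply: he; split; rewrite -ball_normE /=; first exact: close ne ha q1.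
  exact: close ne hb q2.
apply: bigcupT_measurable_rat => a; apply: bigcupT_measurable_rat => b.
apply: bigcupT_measurable => n.
have [h|h] := pselect (box a b n `<=` U).
  rewrite (_ : D a b n = box a b n); last by apply/seteqP; split => x; [case|].
  by apply: measurableX; exact: measurable_itv.
rewrite (_ : D a b n = set0) //; apply/seteqP; split => x //.
by case.
Qed.

Lemma continuous_plane_measurable (f : R * R -> R) : continuous f ->
  measurable_fun setT (f : RR -> R).
Proof.
move=> /continuousP cf; apply: (measurability _ (RGenOpens.measurableE R)).
move=> _ [_ [a [b ->] <-]]; rewrite setTI.
by apply: measurable_open_plane; apply: cf; exact: interval_open.
Qed.

Lemma bounded_continuous_square (f : R * R -> R) (A : R) : continuous f ->
  exists M, forall p, `|p.1| <= A -> `|p.2| <= A -> `|f p| <= M.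
Proof.
move=> cf.
have cK : compact (`[- A, A] `*` `[- A, A] : set (R * R)).
  by apply: compact_setX; exact: segment_compact.
have := @compact_bounded R R^o (f @` (`[- A, A] `*` `[- A, A])).
have /[swap]/[apply] : compact (f @` (`[- A, A] `*` `[- A, A])).
  by apply: continuous_compact => //; exact: continuous_subspaceT.
move=> [M [Mr hM]]; exists (M + 1) => p p1 p2.
apply: (hM (M + 1)); first by rewrite ltrDl.
by exists p => //; split; rewrite /= in_itv /= -ler_norml.
Qed.

(** Compactness of the sphere is split in two: the limit at infinity controls |w| > 1 / r, and the
    remaining w lie in a compact square. *)
Lemma bounded_CP1 (f : CP1 R -> C) : continuous_CP1 f ->
  exists M : R, forall z, `|reC (f z)| <= M /\ `|imC (f z)| <= M.
Proof.
move=> [cf cinf].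
have [c1 c2] := continuous_toC cf.
have e0' : 0 < (1 : Ct) by exact: ltr01.
have /cvgrPdist_lt /(_ _ e0') := cinf.
move=> /nbhs_ballP[d /= d0 h].
have [r r0 dE] := gt0_complex d0.
have [M1 hM1] := bounded_continuous_square r^-1 c1.
have [M2 hM2] := bounded_continuous_square r^-1 c2.
have key (x : C) : `|x| < 1 -> `|reC x| <= 1 /\ `|imC x| <= 1.
  move=> x1; have : sqn x < 1 ^+ 2 by apply: normc_sqn_lt.
  rewrite expr1n /sqn => h1; split; rewrite -(ler_pXn2r (n := 2)) ?nnegrE // expr1n real_normK ?num_real //.
    by have := sqr_ge0 (imC x); lra.
  by have := sqr_ge0 (reC x); lra.
pose M0 := `|reC (f None)| + `|imC (f None)| + 1.
have near_inf (z : CP1 R) : `|f None - f z| < (1 : C) -> `|reC (f z)| <= M0 /\ `|imC (f z)| <= M0.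
  move=> /key; case: (f None) (f z) @M0 => a b [a' b'] /= [h1 h2].
  have n1 := normr_ge0 a; have n2 := normr_ge0 b.
  split.
    have -> : a' = a - (a - a') by ring.
    by apply: le_trans (ler_normB _ _) _; lra.
  have -> : b' = b - (b - b') by ring.
  by apply: le_trans (ler_normB _ _) _; lra.
exists (M0 + `|M1| + `|M2|) => z.
have [n0 n1 n2] : [/\ 0 <= M0, 0 <= `|M1| & 0 <= `|M2|] by rewrite /M0 !addr_ge0.
have wk (x y : R) : x <= M0 /\ y <= M0 -> x <= M0 + `|M1| + `|M2| /\ y <= M0 + `|M1| + `|M2| by lra.
case: z => [w|]; last first.
  by apply: wk; apply: near_inf; rewrite subrr normr0 ltr01.
have [wr|wr] := ltP (r^-1 ^+ 2) (sqn w).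
  have w0 : w != 0.
    apply: contraTneq wr => ->; rewrite -leNgt /sqn /= expr0n addr0 sqr_ge0 //.
  apply/wk/near_inf.
  have -> : Some w = chart_inf w^-1 by rewrite /chart_inf invr_eq0 (negbTE w0) invrK.
  apply: h; rewrite -ball_normE /= dE sub0r normrN.
  apply: normc_lt => //.
  have : sqn w * sqn w^-1 = 1.
    apply: complexI; rewrite rmorphM /= !sqnC rmorphV ?unitfE //= mulrACA mulfV // mul1r mulfV ?rmorph1 //.
    by rewrite conjc_eq0.
  move: (sqn w) (sqn w^-1) wr => x y xr xy.
  have x0 : 0 < x by apply: le_lt_trans xr; exact: sqr_ge0.
  have -> : y = x^-1 by rewrite -[y]mul1r -(mulVf (lt0r_neq0 x0)) -mulrA xy mulr1.
  by rewrite -[_ ^+ 2]invrK ltf_pV2 ?posrE ?invr_gt0 ?exprn_gt0 // -exprVn.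
have wE : w = toC (reC w, imC w) by case: w {wr}.
have [h1 h2] : `|reC w| <= r^-1 /\ `|imC w| <= r^-1.
  have r1 : 0 < r^-1 by rewrite invr_gt0.
  have r2 := ltW r1.
  split; rewrite -(ler_pXn2r (n := 2)) ?nnegrE // real_normK ?num_real //;
    apply: le_trans wr; rewrite /sqn.
    by rewrite lerDl sqr_ge0.
  by rewrite lerDr sqr_ge0.
rewrite wE; have := hM1 (reC w, imC w) h1 h2; have := hM2 (reC w, imC w) h1 h2.
have := ler_norm M1; have := ler_norm M2.
rewrite -wE; lra.
Qed.

Lemma cbm_continuous (f : CP1 R -> C) : continuous_CP1 f -> cbm f.
Proof.
move=> cf; have [M hM] := bounded_CP1 cf.
have [c1 c2] := continuous_toC cf.1.
split; split.
- exact: (continuous_plane_measurable c1).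
- by exists M => z; exact: (hM z).1.
- exact: (continuous_plane_measurable c2).
- by exists M => z; exact: (hM z).2.
Qed.

End Topo.

(** * The eigenvalue as a terminating hypergeometric sum *)

Section Hypergeometric.
Context {R : realType}.

(** For j <= t this is (t!)^2 / ((t - j)! (t + j + 1)!); the falling factorial makes it 0 for t <
    j. *)
Definition berezin_eigenvalue (F : numFieldType) (t j : nat) : F :=
  (t ^_ j * t`!)%:R / ((t + j).+1`!)%:R.

Lemma poch_opp n l : poch (- n%:R : R) l = (-1) ^+ l * (n ^_ l)%:R.
Proof.
elim: l => [|l IH]; first by rewrite /poch big_ord0 mul1r.
rewrite /poch big_ord_recr /= -/(poch _ _) IH ffactnSr exprS natrM.
have [ln|nl] := leqP l n.
  rewrite natrB //; ring.
by rewrite ffact_small // !(mulr0n, mulr0, mul0r).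
Qed.

(** The sums agree term by term. Each Pochhammer symbol at a negative integer is a signed falling
    factorial, and the five signs combine to (-1)^l. For l > mu - m both terms are 0, one through (m
    - mu)_l and the other through the eigenvalue of order mu - l < m. *)
Lemma E_eigenE mu k m : (k <= mu)%N -> (m <= mu)%N ->
  E_eigen R mu k m = ('C(mu, k))%:R * \sum_(l < k.+1)
    ((-1) ^+ (k - l) * ('C(k, l))%:R * berezin_eigenvalue R (mu - l) m).
Proof.
move=> kmu mmu.
have f0 n : (n`!)%:R != 0 :> R by exact: fact_neq0.
rewrite /E_eigen /F32 mulrAC -[_ * \sum_(_ < _) _]mulrA mulr_sumr.
have -> : (-1) ^+ k * ('C(mu, k))%:R * (mu`!)%:R ^+ 2 =
  ('C(mu, k))%:R * ((-1) ^+ k * (mu`!)%:R ^+ 2) :> R by ring.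
rewrite -!mulrA; congr (_ * _); rewrite !mulr_sumr; apply: eq_bigr => l _.
have lk : (l <= k)%N by rewrite -ltnS.
have lmu := leq_trans lk kmu.
rewrite /F32_term.
have -> : m%:R - mu%:R = - (mu - m)%:R :> R by rewrite natrB // opprB.
rewrite !poch_opp.
have sg : (-1) ^+ (k - l) = (-1) ^+ k * (-1) ^+ l :> R.
  by rewrite -signr_odd oddB // signr_addb !signr_odd.
rewrite sg /berezin_eigenvalue.
have kl : (k ^_ l)%:R = ('C(k, l))%:R * (l`!)%:R :> R by rewrite -natrM bin_ffact.
have mul0 : (mu ^_ l)%:R != 0 :> R by rewrite pnatr_eq0 -lt0n ffact_gt0.
have mul : (mu`!)%:R = (mu ^_ l)%:R * ((mu - l)`!)%:R :> R by rewrite -natrM ffact_fact.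
have Ml : ((m + mu + 1)`!)%:R = ((m + mu + 1) ^_ l)%:R * ((mu - l + m).+1`!)%:R :> R.
  rewrite -natrM (_ : (mu - l + m).+1 = m + mu + 1 - l)%N.
    by rewrite ffact_fact // addn1 ltnW // ltnS (leq_trans lmu) // leq_addl.
  by move: lmu; clear; lia.
have M0 : ((m + mu + 1) ^_ l)%:R != 0 :> R.
  by rewrite pnatr_eq0 -lt0n ffact_gt0 addn1 ltnW // ltnS (leq_trans lmu) // leq_addl.
rewrite (addnC mu m) Ml mul kl natrM.
have [lm|ml] := leqP l (mu - m).
  have a1 : ((mu - m)`!)%:R = ((mu - m) ^_ l)%:R * ((mu - m - l)`!)%:R :> R.
    by rewrite -natrM ffact_fact.
  have a2 : ((mu - l)`!)%:R = ((mu - l) ^_ m)%:R * ((mu - m - l)`!)%:R :> R.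
    by rewrite -natrM subnAC ffact_fact // leq_subRL // addnC -leq_subRL.
  have b0 : ((mu - m) ^_ l)%:R != 0 :> R by rewrite pnatr_eq0 -lt0n ffact_gt0.
  rewrite a1 {2}a2.
  have := f0 l; have := f0 (mu - m - l)%N; have := f0 (mu - l + m).+1.
  have := signr_eq0 R l; move: mul0 M0 b0.
  move: (l`!)%:R ((mu - m - l)`!)%:R ((mu - l + m).+1`!)%:R (mu ^_ l)%:R
    ((m + mu + 1) ^_ l)%:R ((mu - m) ^_ l)%:R ((mu - l) ^_ m)%:R ((mu - l)`!)%:R
    ('C(k, l))%:R ((-1) ^+ k) ((-1) ^+ l) => x1 x2 x3 x4 x5 x6 x7 x8 x9 s1 s2.
  move=> n4 n5 n6 /negbT ns n3 n2 n1.
  by field; rewrite ?ns ?n1 ?n2 ?n3 ?n4 ?n5 ?n6.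
have m2 : (mu - l < m)%N by move: ml lmu mmu; clear; lia.
by rewrite (ffact_small ml) (ffact_small m2) !(mulr0n, mulr0, mul0r).
Qed.

End Hypergeometric.

(** * Berezin transforms as equivariant operators of finite rank *)

Section Kernel.
Context {R : realType}.
Local Notation RR := (measurableTypeR R * measurableTypeR R)%type.
Local Notation C := R[i].
Local Notation CP := (CP1 R).

Definition mC (F : RR -> C) :=
  measurable_fun setT (fun p => reC (F p)) /\ measurable_fun setT (fun p => imC (F p)).

Lemma mCM F H : mC F -> mC H -> mC (fun p => F p * H p).
Proof.
move=> [f1 f2] [h1 h2]; split.
  under eq_fun do rewrite reCM.
  by apply: measurable_funB; exact: measurable_funM.
by under eq_fun do rewrite imCM; apply: measurable_funD; exact: measurable_funM.
Qed.

Lemma mCX F n : mC F -> mC (fun p => F p ^+ n).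
Proof.
move=> mF; elim: n => [|n IH].
  by split; exact: measurable_cst.
by under eq_fun do rewrite exprS; exact: mCM.
Qed.

Lemma mC_conj F : mC F -> mC (fun p => conjc (F p)).
Proof.
move=> [f1 f2]; split.
  by rewrite (_ : (fun p => _) = (fun p => reC (F p))) //; apply/funext => p; case: (F p).
rewrite (_ : (fun p => _) = (fun p => - imC (F p))); first exact: measurable_funN.
by apply/funext => p; case: (F p).
Qed.

Lemma mC_toC : mC (@toC R).
Proof. by split; [exact: measurable_fst|exact: measurable_snd]. Qed.

Lemma sqnX (w : C) n : sqn (w ^+ n) = sqn w ^+ n.
Proof.
elim: n => [|n IH]; first by rewrite expr0 sqn1.
by rewrite exprS sqnM IH -exprS.
Qed.

Lemma sqn_real (x : R) : sqn (x%:C) = x ^+ 2.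
Proof. by rewrite /sqn /= expr0n addr0. Qed.

Lemma sqnV (w : C) : sqn w^-1 = (sqn w)^-1.
Proof.
have [->|w0] := eqVneq w 0; first by rewrite invr0 sqn0 invr0.
apply: (mulfI (_ : sqn w != 0)); first by rewrite sqn_eq0.
by rewrite -sqnM !mulfV ?sqn_eq0 // sqn1.
Qed.

(** Each homogeneous coordinate is bounded by the norm, so numerator and denominator compare factor
    by factor. *)
Lemma kermon_le1 j a b (z : CP) : (a <= j)%N -> (b <= j)%N -> sqn (kermon j a b z) <= 1.
Proof.
move=> aj bj; rewrite /kermon !sqnM sqnV sqn_real sqn_conj !sqnM !sqnX.
have N0 := N2_lift_gt0 z.
rewrite ler_pdivrMr ?mul1r ?exprn_gt0 // ?exprn_gt0 //.
have u1 : sqn (lift1 z) <= N2 (lift1 z) (lift2 z) by rewrite lerDl sqn_ge0.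
have v1 : sqn (lift2 z) <= N2 (lift1 z) (lift2 z) by rewrite lerDr sqn_ge0.
have key c : (c <= j)%N -> sqn (lift1 z) ^+ c * sqn (lift2 z) ^+ (j - c) <=
    N2 (lift1 z) (lift2 z) ^+ j.
  move=> cj; rewrite -[X in _ <= _ ^+ X](subnKC cj) exprD ler_pM ?exprn_ge0 ?sqn_ge0 //.
    by rewrite lerXn2r ?nnegrE ?sqn_ge0 // ltW.
  by rewrite lerXn2r ?nnegrE ?sqn_ge0 // ltW.
by rewrite expr2 ler_pM ?key // mulr_ge0 ?exprn_ge0 ?sqn_ge0.
Qed.

Lemma cbm_kermon j a b : (a <= j)%N -> (b <= j)%N -> cbm (kermon j a b : CP -> C).
Proof.
move=> aj bj.
have m : mC (fun p => kermon j a b (Some (toC p))).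
  rewrite /kermon /lift1 /lift2.
  apply: mCM; last first.
    split; last first.
      rewrite (_ : (fun p => _) = (fun _ => 0)); first exact: measurable_cst.
      by apply/funext => p; rewrite -fmorphV.
    rewrite (_ : (fun p => _) = (fun p : RR => (((sqnp p + 1) ^+ j)^-1))); last first.
      apply/funext => p; rewrite -fmorphV /=.
      by rewrite /N2 sqn1 sqnE toCK.
    apply: (measurableT_comp (@measurable_invr R)); apply: measurable_funX.
    by apply: measurable_funD => //; exact: measurable_sqnp.
  have m0 c : mC (fun p => toC p ^+ c * 1 ^+ (j - c)).
    apply: mCM; first exact/mCX/mC_toC.
    by split; exact: measurable_cst.
  by apply: mCM; [exact: m0|apply: mC_conj; exact: m0].
have bd (x : C) : sqn x <= 1 -> `|reC x| <= 1 /\ `|imC x| <= 1.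
  rewrite /sqn => h; split; rewrite -(ler_pXn2r (n := 2)) ?nnegrE // expr1n
    real_normK ?num_real //.
    by have := sqr_ge0 (imC x); lra.
  by have := sqr_ge0 (reC x); lra.
split; split.
- exact: m.1.
- by exists 1 => z; have [] := bd _ (kermon_le1 z aj bj).
- exact: m.2.
- by exists 1 => z; have [] := bd _ (kermon_le1 z aj bj).
Qed.

Lemma cbm_cM c f : @cbm R f -> cbm (fun z => c * f z).
Proof. by move=> cf; exact: (cbmM (cbm_cst c) cf). Qed.

Lemma cbm_ker j (z : CP) : cbm (fun s => (ker z s ^+ j)%:C).
Proof.
rewrite (_ : (fun s => _) = (fun s => \sum_(a < j.+1) \sum_(b < j.+1)
    ('C(j, a))%:R * ('C(j, b))%:R * kermon j a b z * kermon j b a s)); last first.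
  by apply/funext => s; rewrite ker_expand.
apply: cbm_sum => a; apply: cbm_sum => b; apply: cbm_cM; apply: cbm_kermon.
  by rewrite -ltnS.
by rewrite -ltnS.
Qed.

Lemma cbm_ker0X n : cbm (fun z : CP => (ker0 z ^+ n)%:C).
Proof. exact: cbm_ker. Qed.

(** Unlike [Berezin], the result is defined at infinity as well, so that SU(2) acts on it. *)
Definition bertrans tau (f : CP -> C) (z : CP) : C :=
  iint (fun s => (ker z s ^+ tau)%:C * f s).

Lemma Berezin_bertrans tau f z : Berezin tau f z = bertrans tau f (Some z).
Proof.
rewrite /Berezin /bertrans /iint; congr cint; apply/funext => s.
by rewrite mulrA -rmorphM [(_ * iota_density _)%R]mulrC berezin_ker.
Qed.

Lemma bertrans_mobius tau f g z : cbm f -> SU2 g ->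
  bertrans tau f (mobius g z) = bertrans tau (fun s => f (mobius g s)) z.
Proof.
move=> cf hg; rewrite /bertrans -(iint_invariant hg (cbmM (cbm_ker tau _) cf)).
by congr iint; apply/funext => s; rewrite ker_mobius.
Qed.

Lemma bertrans_expand j f z : cbm f -> bertrans j f z =
  \sum_(a < j.+1) \sum_(b < j.+1) ('C(j, a))%:R * ('C(j, b))%:R * kermon j a b z *
    iint (fun s => kermon j b a s * f s).
Proof.
move=> cf; rewrite /bertrans.
have c1 (a b : 'I_j.+1) : cbm (fun s => kermon j b a s * f s).
  by apply: cbmM => //; apply: cbm_kermon; rewrite -ltnS.
under eq_fun do rewrite ker_expand mulr_suml.
rewrite iint_sum; last first.
  move=> a; under eq_fun do rewrite mulr_suml.
  by apply: cbm_sum => b; under eq_fun do rewrite -mulrA; apply: cbm_cM.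
apply: eq_bigr => a _; under eq_fun do rewrite mulr_suml.
rewrite iint_sum; last first.
  by move=> b; under eq_fun do rewrite -mulrA; apply: cbm_cM.
apply: eq_bigr => b _; under eq_fun do rewrite -mulrA.
by rewrite iintZ.
Qed.

Lemma bertransD tau f h z : cbm f -> cbm h ->
  bertrans tau (fun s => f s + h s) z = bertrans tau f z + bertrans tau h z.
Proof.
move=> cf ch; rewrite /bertrans; under eq_fun do rewrite mulrDr.
by rewrite iintD //; apply: cbmM => //; exact: cbm_ker.
Qed.

Lemma bertransZ tau c f z : cbm f -> bertrans tau (fun s => c * f s) z = c * bertrans tau f z.
Proof.
move=> cf; rewrite /bertrans; under eq_fun do rewrite mulrCA.
by rewrite iintZ //; apply: cbmM => //; exact: cbm_ker.
Qed.

Lemma bertrans_sum tau (I : Type) (r : seq I) (f : I -> CP -> C) z :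
  (forall i, cbm (f i)) ->
  bertrans tau (fun s => \sum_(i <- r) f i s) z = \sum_(i <- r) bertrans tau (f i) z.
Proof.
move=> cf; rewrite /bertrans; under eq_fun do rewrite mulr_sumr.
by rewrite iint_sum // => i; apply: cbmM => //; exact: cbm_ker.
Qed.

(* a rotation exchanging 0 and s swaps the two kernels *)
Lemma bertrans_swap i j f : cbm f ->
  iint (fun z => (ker0 z ^+ i)%:C * bertrans j f z) = iint (fun z => (ker0 z ^+ j)%:C * bertrans i f z).
Proof.
move=> cf.
have ac1 (x y z w t : C) : x * (y * z * w * t) = y * z * t * (x * w) by ring.
have ac2 (x y z w t : C) : x * y * z * w * t = x * y * w * (z * t) by ring.
(* The exchange of the integrals over z and s, carried out on the finite expansion of the kernel. *)
have key p q : iint (fun z => (ker0 z ^+ p)%:C * bertrans q f z) =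
    iint (fun s => iint (fun z => (ker0 z ^+ p)%:C * (ker z s ^+ q)%:C) * f s).
  have c1 (a b : 'I_q.+1) : cbm (fun s => kermon q b a s * f s).
    by apply: cbmM => //; apply: cbm_kermon; rewrite -ltnS.
  have c2 (a b : 'I_q.+1) : cbm (fun z : CP => (ker0 z ^+ p)%:C * kermon q a b z).
    by apply: cbmM; [exact: cbm_ker0X|apply: cbm_kermon; rewrite -ltnS].
  transitivity (\sum_(a < q.+1) \sum_(b < q.+1) ('C(q, a))%:R * ('C(q, b))%:R *
     iint (fun z => (ker0 z ^+ p)%:C * kermon q a b z) * iint (fun s => kermon q b a s * f s)).
    rewrite (_ : (fun z => _) = fun z => \sum_(a < q.+1) \sum_(b < q.+1)
       ('C(q, a))%:R * ('C(q, b))%:R * iint (fun s => kermon q b a s * f s) *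
        ((ker0 z ^+ p)%:C * kermon q a b z)); last first.
      apply/funext => z; rewrite bertrans_expand // mulr_sumr; apply: eq_bigr => a _.
      rewrite mulr_sumr; apply: eq_bigr => b _.
      exact: ac1.
    rewrite iint_sum; last by move=> a; apply: cbm_sum => b; apply: cbm_cM.
    apply: eq_bigr => a _; rewrite iint_sum; last by move=> b; apply: cbm_cM.
    apply: eq_bigr => b _; rewrite iintZ //; exact: mulrAC.
  rewrite (_ : (fun s => iint _ * f s) = fun s => \sum_(a < q.+1) \sum_(b < q.+1)
     ('C(q, a))%:R * ('C(q, b))%:R * iint (fun z => (ker0 z ^+ p)%:C * kermon q a b z) *
        (kermon q b a s * f s)); last first.
    apply/funext => s; under eq_fun do rewrite ker_expand mulr_sumr.
    rewrite iint_sum; last first.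
      move=> a; under eq_fun do rewrite mulr_sumr.
      apply: cbm_sum => b; apply: cbmM; first exact: cbm_ker0X.
      under eq_fun do rewrite mulrAC.
      by apply: cbm_cM; apply: cbm_kermon; rewrite -ltnS.
    rewrite mulr_suml; apply: eq_bigr => a _.
    rewrite (_ : (fun z => _) = fun z => \sum_(b < q.+1)
       (('C(q, a))%:R * ('C(q, b))%:R * kermon q b a s) * ((ker0 z ^+ p)%:C * kermon q a b z)); last first.
      by apply/funext => z; rewrite mulr_sumr; apply: eq_bigr => b _; exact: ac1.
    rewrite iint_sum; last by move=> b; apply: cbm_cM.
    by rewrite mulr_suml; apply: eq_bigr => b _; rewrite iintZ //; exact: ac2.
  rewrite iint_sum; last by move=> a; apply: cbm_sum => b; apply: cbm_cM.
  apply: eq_bigr => a _; rewrite iint_sum; last by move=> b; apply: cbm_cM.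
  by apply: eq_bigr => b _; rewrite iintZ.
rewrite !key; congr iint; apply/funext => s; congr (_ * _).
have [g [hg g0 gs]] := mobius_swap s.
have cc : cbm (fun z => (ker0 z ^+ i)%:C * (ker z s ^+ j)%:C).
  apply: cbmM; first exact: cbm_ker0X.
  by under eq_fun do rewrite kerC; exact: cbm_ker.
rewrite -(iint_invariant hg cc); congr iint; apply/funext => z.
have e1 : ker (mobius g z) s = ker0 z by rewrite -g0 ker_mobius // kerC.
have e2 : ker0 (mobius g z) = ker z s by rewrite /ker0 -gs ker_mobius // kerC.
by rewrite e1 e2 mulrC.
Qed.

End Kernel.

(** * The distribution of y and the approximate identity *)

Section Moments.
Context {R : realType}.
Local Notation C := R[i].
Local Notation CP := (CP1 R).

(* the character by which rotations act on kermon j a b *)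
Definition rchar j a b (h : C) : C := h ^+ (a + (j - b)) * conjc h ^+ (j - a + b).

Lemma rcharX j a b h r : rchar j a b (h ^+ r) = rchar j a b h ^+ r.
Proof. by rewrite /rchar rmorphXn /= -!exprM !exprMn -!exprM !(mulnC r). Qed.

(** The character is h^(2(a - b)) with 0 < |a - b| <= j. An order of 2(j + 1) is the least even one
    exceeding every 2|a - b|, so the character is nontrivial, and its (j + 1)-th power is 1. *)
Lemma rchar_prim j a b h : (2 * j.+1).-primitive_root h ->
  (a <= j)%N -> (b <= j)%N -> a != b ->
  rchar j a b h != 1 /\ rchar j a b h ^+ j.+1 = 1.
Proof.
move=> hp aj bj ab.
have sh : sqn h = 1 by apply: (sqn_unity_root _ (prim_expr_order hp)); rewrite muln_gt0.
have hh := conj_unit sh.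
have h0 : h != 0.
  by apply/eqP => h0; move/eqP: hh; rewrite h0 mul0r eq_sym oner_eq0.
have hc : conjc h = h^-1 by apply: (mulfI h0); rewrite hh mulfV.
have e (x y : nat) : (h ^+ x * h^-1 ^+ y == 1) = (x == y %[mod 2 * j.+1]).
  rewrite -(eq_prim_root_expr hp) exprVn -(inj_eq (mulIf (expf_neq0 y h0))).
  by rewrite divfK ?expf_neq0 // mul1r.
rewrite /rchar hc; split.
  rewrite e !modn_small; [|lia..].
  by apply: contra ab => /eqP h1; apply/eqP; lia.
apply/eqP; rewrite exprMn -!exprM e mulnC [X in _ == X %[mod _]]mulnC.
rewrite [(2 * _)%N]mulnC -!muln_modr eqn_pmul2l //.
apply/eqP; lia.
Qed.

Lemma prim_root_rot j : exists2 h : C, (2 * j.+1).-primitive_root h & sqn h = 1.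
Proof.
have [|h hp] := @prim_root_exists R (2 * j.+1); first by rewrite muln_gt0.
exists h => //; apply: (sqn_unity_root _ (prim_expr_order hp)).
by rewrite muln_gt0.
Qed.

Lemma SU2_rot (h : C) : sqn h = 1 -> SU2 (su2 h 0).
Proof. by move=> h1; apply: SU2_su2; rewrite sqn0 addr0. Qed.

Lemma iint_kermon_offdiag j a b : (a <= j)%N -> (b <= j)%N -> a != b ->
  iint (kermon j a b : CP -> C) = 0.
Proof.
move=> aj bj ab; have [h hp sh] := prim_root_rot j.
have [x1 _] := rchar_prim hp aj bj ab.
have ce : cbm (kermon j a b : CP -> C) by exact: cbm_kermon.
have := iint_invariant (SU2_rot sh) ce.
under eq_fun do rewrite kermon_rot //.
rewrite iintZ // -/(rchar j a b h) => /eqP.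
by rewrite -{2}[iint _]mul1r -subr_eq0 -mulrBl mulf_eq0 subr_eq0 (negbTE x1) /= => /eqP.
Qed.

(** By invariance B_n 1 is a constant M, the integral of y^n. Its expansion in (1 - y)^a y^(n - a)
    must therefore be M times that of (y + (1 - y))^n; comparing coefficients, each of the n + 1
    diagonal terms integrates to M, and they add up to 1. *)
Lemma iint_ker0X n : iint (fun z : CP => (ker0 z ^+ n)%:C) = n.+1%:R^-1.
Proof.
set M := iint _; pose m a := iint (kermon n a a : CP -> C).
have BM z : bertrans n (fun _ => 1) z = M.
  have [g [hg <- _]] := mobius_swap z; rewrite bertrans_mobius //; last exact: cbm_cst.
  by rewrite /bertrans /M; congr iint; apply/funext => s; rewrite mulr1.
have E z : \sum_(a < n.+1) ('C(n, a))%:R ^+ 2 * m a *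
    ((1 - ker0 z) ^+ a * ker0 z ^+ (n - a))%:C = M.
  rewrite -(BM z) bertrans_expand; last exact: cbm_cst.
  apply: eq_bigr => a _; have an : (a <= n)%N by rewrite -ltnS.
  rewrite (bigD1 a) //= big1 ?addr0 => [|b ba].
    rewrite kermon_diag //; under eq_fun do rewrite mulr1.
    by rewrite expr2 -!mulrA; congr (_ * (_ * _)); rewrite mulrC.
  under eq_fun do rewrite mulr1.
  by rewrite iint_kermon_offdiag ?mulr0 // -ltnS.
pose d a := ('C(n, a))%:R ^+ 2 * m a - M * ('C(n, a))%:R.
pose p : {poly C} := \poly_(a < n.+1) d a.
have pk k : p.[k%:R] = 0.
  rewrite horner_poly; under eq_bigr do rewrite mulrBl.
  rewrite big_split /= sumrN.
  have k0 : 0 <= k%:R :> R by exact: ler0n.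
  have k1 : 1 + k%:R != 0 :> R by rewrite gt_eqF // ltr_pwDl.
  (* At |w|^2 = k one has y = 1 / (1 + k) and (1 - y) / y = k, so multiplication by (1 + k)^n gives
     a polynomial identity in k, valid at infinitely many points. *)
  pose w : C := (Num.sqrt k%:R)%:C.
  have sw : sqn w = k%:R by rewrite sqn_real sqr_sqrtr.
  have yw : ker0 (Some w) = (1 + k%:R)^-1.
    by rewrite ker0E /= sqn1 /N2 sw sqn1 mul1r addrC.
  have := congr1 (fun x => (1 + k%:R) ^+ n * x) (E (Some w)).
  have -> : (1 + k%:R) ^+ n * M = \sum_(a < n.+1) M * ('C(n, a))%:R * k%:R ^+ a.
    rewrite exprDn mulr_suml; apply: eq_bigr => a _.
    by rewrite expr1n mul1r -mulr_natl mulrC mulrA.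
  move=> <-; rewrite mulr_sumr yw; apply/eqP; rewrite subr_eq0; apply/eqP.
  apply: eq_bigr => a _; have an : (a <= n)%N by rewrite -ltnS.
  rewrite [RHS]mulrCA; congr (_ * _).
  have -> : 1 - (1 + k%:R)^-1 = k%:R / (1 + k%:R) :> R by field.
  rewrite expr_div_n -mulrA exprVn -invfM -exprD subnKC //.
  rewrite rmorphM rmorphXn /= rmorph_nat fmorphV rmorphXn /= rmorphD rmorph1 rmorph_nat /=.
  by rewrite mulrCA mulfV ?mulr1 // expf_neq0.
have p0 : p = 0.
  apply: (@roots_geq_poly_eq0 _ _ [seq (i%:R : C) | i <- iota 0 n.+1]).
  - by apply/allP => x /mapP[i _ ->]; rewrite rootE pk.
  - rewrite map_inj_uniq ?iota_uniq // => i k /eqP; rewrite eqr_nat => /eqP //.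
  - by rewrite size_map size_iota size_poly.
have Cm a : (a <= n)%N -> ('C(n, a))%:R * m a = M.
  move=> an; have := congr1 (fun q : {poly C} => q`_a) p0.
  rewrite coef_poly ltnS an coef0 /d expr2 -mulrA [M * _]mulrC -mulrBr => /eqP.
  by rewrite mulf_eq0 pnatr_eq0 gtn_eqF ?bin_gt0 //= subr_eq0 => /eqP.
(* Integrate the binomial expansion of 1 = (y + (1 - y))^n. *)
have : iint (fun _ : CP => 1 : C) = n.+1%:R * M.
  rewrite (_ : (fun _ => 1) = (fun z : CP => \sum_(a < n.+1) ('C(n, a))%:R * kermon n a a z)).
    rewrite iint_sum; last by move=> a; apply: cbm_cM; apply: cbm_kermon; rewrite -ltnS.
    rewrite (eq_bigr (fun _ => M)); last first.
      move=> a _; have an : (a <= n)%N by rewrite -ltnS.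
      by rewrite iintZ ?Cm //; exact: cbm_kermon.
    by rewrite sumr_const card_ord mulr_natl.
  apply/funext => z; transitivity (((ker0 z + (1 - ker0 z)) ^+ n)%:C).
    by rewrite addrC subrK expr1n.
  rewrite exprDn rmorph_sum /=; apply: eq_bigr => a _.
  have an : (a <= n)%N by rewrite -ltnS.
  by rewrite kermon_diag // rmorphMn /= -mulr_natl [_ ^+ a * _]mulrC.
rewrite iint_cst => h; apply: (mulfI (_ : n.+1%:R != 0 :> C)); first by rewrite pnatr_eq0.
by rewrite -h mulfV // pnatr_eq0.
Qed.

Lemma cbm_poly_ker0 (p : {poly C}) : cbm (fun z : CP => p.[(ker0 z)%:C]).
Proof.
under eq_fun do rewrite horner_coef.
apply: cbm_sum => i; under eq_fun do rewrite -rmorphXn.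
by apply: cbm_cM; exact: cbm_ker0X.
Qed.

Lemma iint_poly_ker0 (p : {poly C}) : iint (fun z : CP => p.[(ker0 z)%:C]) = pint p.
Proof.
under eq_fun do rewrite horner_coef.
rewrite iint_sum; last first.
  by move=> i; under eq_fun do rewrite -rmorphXn; apply: cbm_cM; exact: cbm_ker0X.
apply: eq_bigr => i _; under eq_fun do rewrite -rmorphXn.
by rewrite iintZ ?iint_ker0X //; exact: cbm_ker0X.
Qed.

Lemma ker0_ge0 (z : CP) : 0 <= ker0 z.
Proof. by rewrite ker0E divr_ge0 ?sqn_ge0 ?N2_ge0. Qed.

(** Bernoulli's inequality is only linear in n; taking an even exponent and squaring it gives
    quadratic growth, which beats K (n + 1). *)
Lemma pow_bound (K x : R) : 0 < x -> exists n, K * n.+1%:R < (1 + x) ^+ n.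
Proof.
move=> x0.
have bern k : 1 + k%:R * x <= (1 + x) ^+ k.
  elim: k => [|k IH]; first by rewrite mul0r addr0.
  rewrite exprS -natr1; have k0 := ler0n R k.
  apply: le_trans (_ : (1 + x) * (1 + k%:R * x) <= _); last first.
    by rewrite ler_pM2l // addr_gt0.
  by move: (k%:R) k0 => k' k0; nra.
pose K' := `|K| + 1.
have K0 : 0 < K' by rewrite ltr_wpDl.
pose k := (Num.truncn (3 * K' / x ^+ 2)).+1.
have kK : 3 * K' / x ^+ 2 < k%:R.
  by rewrite truncnS_gt // divr_ge0 ?mulr_ge0 ?sqr_ge0 // ltW.
have k1 : 1 <= k%:R :> R by rewrite ler1n.
exists (k * 2)%N; rewrite exprM.
apply: lt_le_trans (_ : (1 + k%:R * x) ^+ 2 <= _); last first.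
  by rewrite lerXn2r ?nnegrE ?bern // ?exprn_ge0 ?addr_ge0 ?mulr_ge0 // ltW.
have -> : (k * 2).+1%:R = 2 * k%:R + 1 :> R by rewrite -natr1 natrM mulrC.
move: kK; rewrite ltr_pdivrMr ?exprn_gt0 // => kK.
have KK : K <= K' by rewrite /K' (le_trans (ler_norm K)) // lerDl.
clearbody k; clearbody K'; move: (k%:R) k1 kK => k' k1 kK.
have h1 : K * (2 * k' + 1) <= K' * (3 * k') by nra.
have h2 : K' * (3 * k') < k' * (k' * x ^+ 2) by nra.
have h3 : k' * (k' * x ^+ 2) <= (1 + k' * x) ^+ 2 by nra.
lra.
Qed.

(* (n + 1) ker0^n d iota is an approximate identity at 0 *)
Lemma vanish_at0 (f : CP -> C) : continuous_CP1 f ->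
  (forall n, bertrans n f (Some 0) = 0) -> f (Some 0) = 0.
Proof.
move=> ctf Bf; have cf := cbm_continuous ctf.
apply/eqP; apply: contraT => f0.
pose h z := (f (Some 0))^-1 * f z.
have ch : cbm h by exact: cbm_cM.
have Bh n : bertrans n h (Some 0) = 0 by rewrite bertransZ // Bf mulr0.
have h0 : h (Some 0) = 1 by rewrite /h mulVf.
have [M hM] := ch.1.2.
have M0 : 0 <= M by exact: le_trans (normr_ge0 _) (hM None).
have e0 : 0 < Num.sqrt (sqn (f (Some 0))) / 2.
  by rewrite divr_gt0 // sqrtr_gt0 lt_neqAle sqn_ge0 eq_sym sqn_eq0 f0.
have [d d0 hd] := continuous_eps (ctf.1 0) e0.
have near0 w : sqn w < d ^+ 2 -> 2^-1 <= reC (h (Some w)).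
  move=> wd; have := hd w; rewrite subr0 => /(_ wd).
  rewrite expr_div_n sqr_sqrtr ?sqn_ge0 // => h1.
  have : sqn (h (Some w) - 1) < 2^-1 ^+ 2.
    rewrite -h0 /h -mulrBr sqnM sqnV mulrC.
    have s0 : 0 < sqn (f (Some 0)) by rewrite lt_neqAle sqn_ge0 eq_sym sqn_eq0 f0.
    by rewrite ltr_pdivrMr // mulrC exprVn.
  rewrite /sqn reCD /= => h2.
  have := sqr_ge0 (imC (h (Some w) - 1)); move: h2.
  move: (imC _) (reC (h (Some w))) => y x h2 y2.
  have : (x - 1) ^+ 2 < 2^-1 ^+ 2 by lra.
  by move=> h3; nra.
have d20 : 0 < d ^+ 2 by rewrite exprn_gt0.
pose rho := (1 + d ^+ 2)^-1.
have rho0 : 0 < rho by rewrite invr_gt0 addr_gt0.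
(* Near 0 the real part of h is at least 1/2; elsewhere y <= rho and |Re h| <= M. Integration gives
   1 / (2(n + 1)) <= (M + 1/2) rho^n for every n, which fails for some n since rho < 1. *)
have low n z : ker0 z ^+ n * 2^-1 - (M + 2^-1) * rho ^+ n <= ker0 z ^+ n * reC (h z).
  have y0 := exprn_ge0 n (ker0_ge0 z).
  have r0 := exprn_ge0 n (ltW rho0).
  have := hM z; rewrite ler_norml => /andP[hz _].
  have [[w [zw wd]]|far] := pselect (exists w, z = Some w /\ sqn w < d ^+ 2).
    subst z.
    have := near0 w wd; move: y0; move: (ker0 (Some w) ^+ n) (rho ^+ n) r0 (reC _) => y r r0 x y0 x0.
    by nra.
  have yr : ker0 z ^+ n <= rho ^+ n.
    rewrite lerXn2r ?nnegrE ?ker0_ge0 ?(ltW rho0) //.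
    case: z far {hz y0} => [w|] far; last first.
      by rewrite ker0E /= sqn0 mul0r ltW.
    have wd : d ^+ 2 <= sqn w by rewrite leNgt; apply/negP => wd; apply: far; exists w.
    rewrite ker0E /= sqn1 mul1r /N2 sqn1 lef_pV2 ?posrE; first by rewrite [_ + 1]addrC lerD2l.
      by rewrite addr_gt0 // (lt_le_trans d20).
    by rewrite addr_gt0.
  by move: (ker0 z ^+ n) (rho ^+ n) y0 r0 yr (reC (h z)) hz => y r y0 r0 yr x hz; nra.
have ry n : rbm (fun z : CP => ker0 z ^+ n) by have := (@cbm_ker0X R n).1.
have main n : n.+1%:R^-1 * 2^-1 - (M + 2^-1) * rho ^+ n <= 0.
  have Jy : Jr (fun z : CP => ker0 z ^+ n) = n.+1%:R^-1.
    have := iint_ker0X n; rewrite iintE /= => /(congr1 (@reC R)) /= ->.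
    by rewrite -(rmorph_nat (real_complex R)) -fmorphV.
  have Jh : Jr (fun z => ker0 z ^+ n * reC (h z)) = 0.
    have := Bh n; rewrite /bertrans iintE => /(congr1 (@reC R)) /= <-.
    by congr Jr; apply/funext => z; rewrite reCM /= mul0r subr0.
  rewrite -Jh -Jy.
  apply: le_trans (_ : Jr (fun z => ker0 z ^+ n * 2^-1 - (M + 2^-1) * rho ^+ n) <= _).
    have r1 : rbm (fun z : CP => ker0 z ^+ n * 2^-1) by exact: (rbmM (ry n) (rbm_cst _)).
    rewrite (JrD r1 (rbm_cst _)) Jr_cst lerD2r.
    under [in X in _ <= X]eq_fun do rewrite mulrC.
    by rewrite JrZ // mulrC.
  apply: Jr_le.
  - by apply: rbmD; [exact: (rbmM (ry n) (rbm_cst _))|exact: rbm_cst].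
  - by apply: rbmM; [exact: ry|exact: ch.1].
  - by move=> z; exact: low.
have [n hn] := pow_bound (2 * M + 1) d20.
have := main n; rewrite /rho exprVn.
have n0 : 0 < n.+1%:R :> R by rewrite ltr0n.
have X0 : 0 < (1 + d ^+ 2) ^+ n by rewrite exprn_gt0 // addr_gt0.
move: hn; move: (n.+1%:R) n0 ((1 + d ^+ 2) ^+ n) X0 => N N0 X X0 hn.
rewrite subr_le0 -ler_pdivrMr ?invr_gt0 // invrK => h1.
have h2 : N^-1 * 2^-1 * X * N <= (M + 2^-1) * N by rewrite ler_pM2r.
have h3 : N^-1 * 2^-1 * X * N = 2^-1 * X by field; rewrite gt_eqF.
by rewrite h3 in h2; clear - hn h2; lra.
Qed.

End Moments.

(** * Averages over j + 1 rotations about 0 *)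

Section Rotations.
Context {R : realType}.
Local Notation C := R[i].
Local Notation CP := (CP1 R).

Lemma mobius_rot0 (h : C) : sqn h = 1 -> mobius (su2 h 0) (Some 0) = Some 0.
Proof.
move=> h1; have [e1 e2 e3 e4] := su2E h 0.
rewrite /mobius e1 e2 e3 e4 !mulr0 !add0r mul0r.
by rewrite -sqn_eq0 sqn_conj h1 oner_eq0.
Qed.

Lemma ker0_rot (h : C) z : sqn h = 1 -> ker0 (mobius (su2 h 0) z) = ker0 z.
Proof. by move=> h1; rewrite /ker0 -{1}(mobius_rot0 h1) ker_mobius //; exact: SU2_rot. Qed.

(** A geometric sum: off the diagonal the ratio differs from 1 while its (j + 1)-th power is 1, so
    the sum is 0. *)
Lemma sum_rot_kermon j a b (h : C) z : (2 * j.+1).-primitive_root h -> sqn h = 1 ->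
  (a <= j)%N -> (b <= j)%N ->
  \sum_(r < j.+1) kermon j a b (mobius (su2 (h ^+ r) 0) z) =
  (if a == b then j.+1%:R else 0) * kermon j a b z.
Proof.
move=> hp h1 aj bj.
under eq_bigr do rewrite kermon_rot ?sqnX ?h1 ?expr1n // -/(rchar j a b _) rcharX.
rewrite -mulr_suml; congr (_ * _).
have [<-|ab] := eqVneq a b; last first.
  have [x1 xj] := rchar_prim hp aj bj ab.
  have x0 : rchar j a b h - 1 != 0 by rewrite subr_eq0.
  by apply: (mulfI x0); rewrite -subrX1 xj subrr mulr0.
have -> : rchar j a a h = 1.
  by rewrite /rchar addnC -exprMn conj_unit // expr1n.
by under eq_bigr do rewrite expr1n; rewrite sumr_const card_ord.
Qed.

End Rotations.

(** * Berezin transforms on an irreducible space *)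

Section Irreducible.
Context {R : realType} (m : nat) (V : set (CP1 R -> R[i])) (hV : is_Htilde m V).
Local Notation C := R[i].
Local Notation CP := (CP1 R).

Lemma Htilde_cbm f : V f -> cbm f.
Proof. by move=> /hV.2.2.2.2; exact: cbm_continuous. Qed.

Lemma Htilde_sum (I : Type) (r : seq I) (f : I -> CP -> C) : (forall i, V (f i)) ->
  V (fun z => \sum_(i <- r) f i z).
Proof.
move=> Vf; elim: r => [|i r IH].
  by under eq_fun do rewrite big_nil; exact: hV.1.1.
by under eq_fun do rewrite big_cons; exact: hV.1.2.1.
Qed.

Lemma Htilde_mobius g f : SU2 g -> V f -> V (fun z => f (mobius g z)).
Proof. by move=> hg /(hV.2.1 _ (SU2V hg)); rewrite /act invmxK. Qed.

Lemma Htilde_nonzero : exists2 f, V f & f (Some 0) != 0.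
Proof.
have [[f [Vf f0]] _] := hV.2.2.1.
have [z fz] : exists z, f z != 0.
  apply: contra_notP f0 => h; apply/funext => z.
  by apply/eqP; apply: contraT => fz; case: h; exists z.
have [g [hg g0 _]] := mobius_swap z.
by exists (fun z => f (mobius g z)); [exact: Htilde_mobius|rewrite g0].
Qed.

(** If every B_n f vanished at 0 for all f in V, the approximate identity would make all f vanish at
    0. Equivariance extends the vanishing below j from 0 to all points. *)
Lemma level_exists : exists j,
  (forall i f z, (i < j)%N -> V f -> bertrans i f z = 0) /\
  exists2 f, V f & bertrans j f (Some 0) != 0.
Proof.
pose P n := `[< exists2 f, V f & bertrans n f (Some 0) != 0 >].
have exP : exists n, P n.
  have [f Vf f0] := Htilde_nonzero.
  apply: contrapT => nP; move/eqP: f0; apply; apply: vanish_at0.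
    exact: hV.2.2.2.2.
  move=> n; apply/eqP; apply: contraT => h.
  by case: nP; exists n; apply/asboolP; exists f.
case: (ex_minnP exP) => j /asboolP Pj minj; exists j; split=> // i f z ij Vf.
have [g [hg <- _]] := mobius_swap z; rewrite bertrans_mobius //; last exact: Htilde_cbm.
apply/eqP; apply: contraTT ij => h; rewrite -leqNgt minj //.
by apply/asboolP; exists (fun z => f (mobius g z)) => //; exact: Htilde_mobius.
Qed.

Section Level.
Context (j : nat) (lowj : forall i f z, (i < j)%N -> V f -> bertrans i f z = 0)
  (topj : exists2 f, V f & bertrans j f (Some 0) != 0).

(** The kernel of B_j in V is an invariant subspace and is not V by the choice of j, so
    irreducibility makes it 0. *)
Lemma bertrans_inj f : V f -> (forall z, bertrans j f z = 0) -> forall z, f z = 0.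
Proof.
move=> Vf Bf; pose W := [set f | V f /\ forall z, bertrans j f z = 0].
have sW : is_subspace W.
  split; first split; first exact: hV.1.1.
    by move=> z; rewrite /bertrans; under eq_fun do rewrite mulr0; exact: iint_cst.
  split=> [f1 f2 [V1 B1] [V2 B2]|c f1 [V1 B1]]; split.
  - exact: hV.1.2.1.
  - by move=> z; rewrite bertransD ?B1 ?B2 ?addr0 //; exact: Htilde_cbm.
  - exact: hV.1.2.2.
  - by move=> z; rewrite bertransZ ?B1 ?mulr0 //; exact: Htilde_cbm.
have iW : SU2_invariant W.
  move=> g hg f1 [V1 B1]; split; first exact: hV.2.1.
  by move=> z; rewrite /act -bertrans_mobius ?B1 //; [exact: Htilde_cbm|exact: SU2V].
have WV : W `<=` V by move=> f1 [].
have [W0|WE] := hV.2.2.1.2 _ sW iW WV.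
  have : W f by [].
  by rewrite W0 => /= ->.
have [f1 V1] := topj; have : W f1 by rewrite WE.
by case=> _ ->; rewrite eqxx.
Qed.

Context (h : C) (hp : (2 * j.+1).-primitive_root h) (h1 : sqn h = 1).

Definition rot_avg (f : CP -> C) (z : CP) : C :=
  j.+1%:R^-1 * \sum_(r < j.+1) f (mobius (su2 (h ^+ r) 0) z).

Let hr r : sqn (h ^+ r) = 1. Proof. by rewrite sqnX h1 expr1n. Qed.
Let j0 : j.+1%:R != 0 :> C. Proof. by rewrite pnatr_eq0. Qed.

Lemma Htilde_avg f : V f -> V (rot_avg f).
Proof.
move=> Vf; apply: hV.1.2.2; apply: Htilde_sum => r; apply: Htilde_mobius => //.
exact: SU2_rot.
Qed.

Lemma rot_avg0 f : rot_avg f (Some 0) = f (Some 0).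
Proof.
rewrite /rot_avg; under eq_bigr do rewrite mobius_rot0 //.
by rewrite sumr_const card_ord -[X in _ * X]mulr_natl mulKf.
Qed.

Lemma bertrans_avg t f z : V f -> bertrans t (rot_avg f) z = rot_avg (bertrans t f) z.
Proof.
move=> Vf; have cf (r : 'I_j.+1) : cbm (fun z => f (mobius (su2 (h ^+ r) 0) z)).
  by apply: Htilde_cbm; apply: Htilde_mobius => //; exact: SU2_rot.
rewrite bertransZ; last exact: cbm_sum.
rewrite (bertrans_sum _ _ _ cf); congr (_ * _); apply: eq_bigr => r _.
by rewrite bertrans_mobius //; [exact: Htilde_cbm|exact: SU2_rot].
Qed.

Lemma bertrans_avg0 t f : V f -> bertrans t (rot_avg f) (Some 0) = bertrans t f (Some 0).
Proof. by move=> Vf; rewrite bertrans_avg // rot_avg0. Qed.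

(** Averaging removes the off-diagonal coefficients of the kernel, and the diagonal ones are
    polynomials in y. *)
Lemma bertrans_avg_poly f : V f -> exists2 q : {poly C}, (size q <= j.+1)%N &
  forall z, bertrans j (rot_avg f) z = q.[(ker0 z)%:C].
Proof.
move=> Vf; have cf := Htilde_cbm Vf.
exists (\sum_(a < j.+1) (('C(j, a))%:R ^+ 2 * iint (fun s => kermon j a a s * f s)) *:
  ((1 - 'X) ^+ a * 'X^(j - a))).
  apply: (leq_trans (size_sum _ _ _)); apply/bigmax_leqP => a _.
  apply: (leq_trans (size_scale_leq _ _)).
  apply: (leq_trans (size_polyMleq _ _)).
  have s2 : (size (1 - 'X : {poly C})%R <= 2)%N.
    by rewrite (leq_trans (size_polyD _ _)) // size_polyN size_polyX size_poly1.
  have sa : (size ((1 - 'X : {poly C}) ^+ a)%R <= a.+1)%N.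
    apply: (leq_trans (size_poly_exp_leq _ _)); rewrite ltnS -{2}[a : nat]mul1n.
    by rewrite leq_mul2r -subn1 leq_subLR s2 orbT.
  have aj : (a <= j)%N by rewrite -ltnS.
  rewrite size_polyXn -subn1 leq_subLR -(leq_add2r (j - a).+1) in sa *.
  by apply: (leq_trans sa); rewrite addSn addnS subnKC // add1n.
move=> z; rewrite bertrans_avg // /rot_avg.
under eq_bigr do rewrite bertrans_expand //.
rewrite exchange_big /= mulr_sumr horner_sum; apply: eq_bigr => a _.
have aj : (a <= j)%N by rewrite -ltnS.
rewrite exchange_big /=.
transitivity (j.+1%:R^-1 * \sum_(b < j.+1) ('C(j, a))%:R * ('C(j, b))%:R *
   ((if a == b :> nat then j.+1%:R else 0) * kermon j a b z) *
    iint (fun s => kermon j b a s * f s)).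
  congr (_ * _); apply: eq_bigr => b _.
  have bj : (b <= j)%N by rewrite -ltnS.
  by rewrite -(sum_rot_kermon _ hp h1) // mulr_sumr mulr_suml.
rewrite (bigD1 a) //= eqxx big1 ?addr0; last first.
  by move=> b ba; rewrite eq_sym val_eqE (negbTE ba) mul0r mulr0 mul0r.
rewrite hornerZ hornerM !horner_exp hornerD hornerN hornerX hornerC kermon_diag //.
rewrite rmorphM !rmorphXn rmorphB rmorph1 /=.
move: (iint _) ((1 - _) ^+ a) (_ ^+ (j - a)) ('C(j, a)%:R : C) => I x y c.
rewrite expr2 -!mulrA; move: j0; move: (j.+1%:R : C) => N N0.
by field.
Qed.

(** By symmetry the pairing of y^i with B_j g equals that of y^j with B_i g, which is 0 for i < j.
    The scalar is the value at 0, where y = 1. *)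
Lemma bertrans_avg_legendre f z : V f ->
  bertrans j (rot_avg f) z = bertrans j f (Some 0) * (legendre j).[(ker0 z)%:C].
Proof.
move=> Vf; have [q sq qE] := bertrans_avg_poly Vf.
have q1 : q.[1] = bertrans j f (Some 0) by rewrite -bertrans_avg0 // qE ker0_0.
rewrite qE -q1 -hornerZ -legendre_unique // => i ij.
rewrite -iint_poly_ker0.
transitivity (iint (fun z : CP => (ker0 z ^+ i)%:C * bertrans j (rot_avg f) z)).
  congr iint; apply/funext => s.
  by rewrite hornerM hornerXn qE mulrC rmorphXn.
rewrite bertrans_swap; last exact/Htilde_cbm/Htilde_avg.
transitivity (iint (fun _ : CP => (0 : C))); last exact: iint_cst.
congr iint; apply/funext => s.
by rewrite lowj ?mulr0 //; exact: Htilde_avg.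
Qed.

(** The average of f has the same value at 0 as f, and the hypothesis makes its image under the
    injective B_j vanish identically. *)
Lemma bertrans0_eq0 f : V f -> bertrans j f (Some 0) = 0 -> f (Some 0) = 0.
Proof.
move=> Vf B0; rewrite -rot_avg0; apply: bertrans_inj; first exact: Htilde_avg.
by move=> z; rewrite bertrans_avg_legendre // B0 mul0r.
Qed.

(** On V the functional f -> B_j f(0) is nonzero and its kernel lies in that of f -> f(0), so the
    second is a multiple of the first; equivariance moves 0 to z. *)
Lemma bertrans_proportional : exists c, forall f z, V f -> f z = c * bertrans j f z.
Proof.
have [f0 V0 B0] := topj; set c := f0 (Some 0) / bertrans j f0 (Some 0).
have at0 f : V f -> f (Some 0) = c * bertrans j f (Some 0).
  move=> Vf; pose x := - (bertrans j f (Some 0) / bertrans j f0 (Some 0)).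
  have Vx : V (fun z => x * f0 z) by exact: hV.1.2.2.
  have := @bertrans0_eq0 (fun z => f z + x * f0 z); rewrite bertransD; [|exact: Htilde_cbm..].
  rewrite bertransZ; last exact: Htilde_cbm.
  rewrite [x * bertrans _ _ _]mulNr divfK // subrr => /(_ (hV.1.2.1 _ _ Vf Vx) erefl).
  move=> /eqP; rewrite addr_eq0 => /eqP ->.
  by rewrite mulNr opprK /c mulrAC [RHS]mulrAC [f0 _ * _]mulrC.
exists c => f z Vf; have [g [hg <- _]] := mobius_swap z.
rewrite bertrans_mobius //; last exact: Htilde_cbm.
exact: (at0 _ (Htilde_mobius hg Vf)).
Qed.

Lemma rot_avgE f z : V f -> rot_avg f z = f (Some 0) * (legendre j).[(ker0 z)%:C].
Proof.
move=> Vf; have [c cE] := bertrans_proportional.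
by rewrite (cE _ z (Htilde_avg Vf)) bertrans_avg_legendre // mulrA -cE.
Qed.

(** Moving z to 0 and averaging leaves the integral of y^t times f(0) P_j(y), a moment of the
    Legendre polynomial. *)
Lemma bertrans_eigen t f z : V f -> bertrans t f z = berezin_eigenvalue C t j * f z.
Proof.
move=> Vf; have [g [hg <- _]] := mobius_swap z.
rewrite bertrans_mobius //; last exact: Htilde_cbm.
have Vg := Htilde_mobius hg Vf.
rewrite -bertrans_avg0 // /berezin_eigenvalue -pint_Xn_legendre -iint_poly_ker0 mulrC.
rewrite -[f _]/((fun z => f (mobius g z)) (Some 0)).
rewrite -iintZ; last exact: cbm_poly_ker0.
rewrite /bertrans; congr iint; apply/funext => s.
rewrite rot_avgE // -/(ker0 s) hornerM hornerXn rmorphXn /=.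
by rewrite mulrCA.
Qed.

Definition zonal (z : CP) : C := (legendre j).[(ker0 z)%:C].

Lemma Htilde_zonal : V zonal.
Proof.
have [f Vf f0] := Htilde_nonzero; rewrite (_ : zonal = fun z => (f (Some 0))^-1 * rot_avg f z).
  by apply: hV.1.2.2; exact: Htilde_avg.
by apply/funext => z; rewrite rot_avgE // mulKf.
Qed.

(** Since [zonal] is rotation invariant, f may be replaced by its average f(0) P_j(y); the constant
    is the integral of P_j^2. *)
Lemma iint_zonal f : V f ->
  iint (fun z => f z * zonal z) = j.*2.+1%:R^-1 * f (Some 0).
Proof.
move=> Vf; have cz := Htilde_cbm Htilde_zonal; have cf := Htilde_cbm Vf.
transitivity (iint (fun z => rot_avg f z * zonal z)).
  have cr (r : 'I_j.+1) : cbm (fun z => f (mobius (su2 (h ^+ r) 0) z) * zonal z).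
    apply: cbmM => //; apply: cbm_mobius => //; exact: SU2_rot.
  rewrite (_ : (fun z => rot_avg f z * zonal z) = fun z => j.+1%:R^-1 *
     \sum_(r < j.+1) f (mobius (su2 (h ^+ r) 0) z) * zonal z); last first.
    by apply/funext => z; rewrite /rot_avg -mulrA mulr_suml.
  rewrite iintZ; last exact: cbm_sum.
  rewrite (iint_sum _ cr) (eq_bigr (fun _ => iint (fun z => f z * zonal z))).
    by rewrite sumr_const card_ord -[X in _ * X]mulr_natl mulKf.
  move=> r _; rewrite -(iint_invariant (SU2_rot (hr r)) (cbmM cf cz)).
  by congr iint; apply/funext => z; rewrite /zonal ker0_rot.
rewrite -pint_legendre_sqr -iint_poly_ker0 mulrC -iintZ; last exact: cbm_poly_ker0.
by congr iint; apply/funext => z; rewrite rot_avgE // hornerM mulrA.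
Qed.

Lemma reproducing z : exists zeta, [/\ V zeta, zeta z = 1 &
  forall f, V f -> iint (fun w => f w * zeta w) = j.*2.+1%:R^-1 * f z].
Proof.
have [g [hg g0 _]] := mobius_swap z; have hg' := SU2V hg.
exists (fun w => zonal (mobius (invmx g) w)); split.
- exact: (Htilde_mobius hg' Htilde_zonal).
- by rewrite -g0 mobiusKV // /zonal ker0_0 legendre1.
move=> f Vf; have cz := Htilde_cbm (Htilde_mobius hg' Htilde_zonal).
rewrite -(iint_invariant hg (cbmM (Htilde_cbm Vf) cz)) -g0.
rewrite -(iint_zonal (Htilde_mobius hg Vf)).
by congr iint; apply/funext => w; rewrite mobiusKV.
Qed.

(* integrate the reproducing kernel over the diagonal *)
Lemma level_dim : j = m.
Proof.
have [b [Vb [bfree bspan]]] := hV.2.2.2.1; set n := m.*2.+1 in b Vb bfree bspan.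
pose G := \matrix_(k < n, i < n) iint (fun z => b k z * b i z).
have cbb k i : cbm (fun z => b k z * b i z) by apply: cbmM; exact: Htilde_cbm.
have k0 : j.*2.+1%:R != 0 :> C by rewrite pnatr_eq0.
have Gf (c : 'I_n -> C) k : iint (fun z => b k z * \sum_i c i * b i z) = \sum_i G k i * c i.
  transitivity (iint (fun z => \sum_i c i * (b k z * b i z))).
    by congr iint; apply/funext => z; rewrite mulr_sumr; apply: eq_bigr => i _; rewrite mulrCA.
  rewrite iint_sum; last by move=> i; apply: cbm_cM.
  by apply: eq_bigr => i _; rewrite iintZ // mxE mulrC.
have rep z : exists2 c : 'I_n -> C, \sum_i c i * b i z = 1 &
    forall k, \sum_i G k i * c i = j.*2.+1%:R^-1 * b k z.
  have [zeta [Vz z1 zE]] := reproducing z; have [c cE] := bspan _ Vz.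
  exists c; first by rewrite -cE.
  move=> k; rewrite -Gf -zE //; congr iint; apply/funext => w; by rewrite cE.
(* If v G = 0, the function with coordinates v pairs to 0 with the reproducing element of every z,
   hence vanishes at every z; independence of the basis gives v = 0. *)
have uG : G \in unitmx.
  rewrite -row_free_unit; apply: inj_row_free => v vG.
  apply/rowP => k; rewrite mxE; move: k; apply: bfree => z.
  have [c _ cE] := rep z; apply: (mulfI (invr_neq0 k0)); rewrite mulr0 mulr_sumr.
  transitivity (\sum_k v ord0 k * \sum_i G k i * c i).
    by apply: eq_bigr => k _; rewrite cE mulrCA.
  transitivity (\sum_i (v *m G) ord0 i * c i).
    under eq_bigr do rewrite mulr_sumr.
    rewrite exchange_big /=; apply: eq_bigr => i _.
    by rewrite mxE mulr_suml; apply: eq_bigr => k _; rewrite mulrA.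
  by rewrite vG; apply: big1 => i _; rewrite mxE mul0r.
(* The coordinates of the reproducing element at z are G^-1 applied to the vector of values b(z) /
   (2j + 1); its own value at z is 1. *)
have one z : 1 = j.*2.+1%:R^-1 * \sum_i \sum_k invmx G i k * (b k z * b i z).
  have [c c1 cE] := rep z; transitivity (\sum_i c i * b i z); first by [].
  rewrite mulr_sumr; apply: eq_bigr => i _.
  have -> : c i = \sum_k invmx G i k * (j.*2.+1%:R^-1 * b k z).
    have := congr1 (fun M : 'cV_n => M i ord0) (mulKmx uG (\col_k c k)).
    rewrite !mxE => <-; apply: eq_bigr => k _; rewrite -cE mxE.
    by congr (_ * _); apply: eq_bigr => l _; rewrite [(\col__ _) _ _]mxE.
  rewrite mulr_suml mulr_sumr; apply: eq_bigr => k _.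
  by rewrite -!mulrA mulrCA.
have : iint (fun _ : CP => (1 : C)) = j.*2.+1%:R^-1 * n%:R.
  have ci i : cbm (fun z => \sum_k invmx G i k * (b k z * b i z)).
    by apply: cbm_sum => k; apply: cbm_cM.
  transitivity (iint (fun z : CP => j.*2.+1%:R^-1 *
      \sum_i \sum_k invmx G i k * (b k z * b i z))).
    by congr iint; apply/funext => z; exact: one.
  rewrite iintZ; last exact: cbm_sum.
  (* Integrating b_k b_i restores the Gram matrix, so the double sum is the trace of G^-1 G, which
     is n. *)
  rewrite (iint_sum _ ci) -(mxtrace1 C n) -(mulVmx uG); congr (_ * _).
  apply: eq_bigr => i _; rewrite mxE iint_sum; last by move=> k; apply: cbm_cM.
  by apply: eq_bigr => k _; rewrite iintZ // mxE.
rewrite iint_cst => /(congr1 (fun x => j.*2.+1%:R * x)).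
rewrite mulr1 mulVKf // => /eqP; rewrite eqr_nat => /eqP [] /double_inj //.
Qed.

End Level.

Lemma Berezin_eigen t f z : V f -> Berezin t f z = berezin_eigenvalue C t m * f (Some z).
Proof.
move=> Vf; have [j [lowj topj]] := level_exists.
have [h hp h1] := @prim_root_rot R j.
by rewrite Berezin_bertrans (bertrans_eigen lowj topj hp h1) // (level_dim lowj topj hp h1).
Qed.

End Irreducible.

Theorem mainTheorem11 (R : realType) (mu k m : nat) (hk : (k <= mu)%N)
  (V : set (CP1 R -> R[i])) (hV : is_Htilde m V) :
  ((m <= mu)%N -> forall f, V f -> forall z : R[i],
      Eop mu k f z = (E_eigen R mu k m)%:C * f (Some z)) /\
  ((mu < m)%N -> forall f, V f -> forall z : R[i], Eop mu k f z = 0).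
Proof.
split=> hm f Vf z; rewrite /Eop; last first.
  (* Every order mu - l is below m, so each eigenvalue contains a vanishing falling factorial. *)
  rewrite big1 ?mulr0 // => l _; rewrite (Berezin_eigen hV) // /berezin_eigenvalue ffact_small.
    by rewrite mul0n !mul0r mulr0.
  by rewrite (leq_ltn_trans _ hm) // leq_subr.
rewrite E_eigenE // rmorphM rmorph_nat -mulrA; congr (_ * _).
rewrite rmorph_sum mulr_suml; apply: eq_bigr => l _ /=.
rewrite (Berezin_eigen hV) // mulrA; congr (_ * _).
rewrite !rmorphM rmorphXn rmorphN1 rmorph_nat; congr (_ * _).
by rewrite /berezin_eigenvalue rmorphM fmorphV !rmorph_nat.
Qed.
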